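(* Let $n\in\mathbb{N}$ and let $p$ be a prime. Let $P\in\mathrm{Syl}_p(S_n)$ and let $\chi,\psi\in\mathrm{Irr}(S_n)$. If $\mathrm{Van}(\chi\downarrow_P)\subseteq\mathrm{Van}(\psi\downarrow_P)$, then $\chi(1)_p\le\psi(1)_p$. In particular, if $\mathrm{Van}(\chi\downarrow_P)=\mathrm{Van}(\psi\downarrow_P)$, then $\chi(1)_p=\psi(1)_p$.
   Context: $\mathrm{Irr}(G)$ denotes the set of irreducible complex characters of a finite group $G$, and $\chi\downarrow_P$ is the restriction of $\chi$ to $P$. For a character $\xi$ of a finite group $G$, $\mathrm{Van}(\xi)=\{g\in G\mid \xi(g)=0\}$; thus $\mathrm{Van}(\chi\downarrow_P)=\{g\in P\mid\chi(g)=0\}$. For an integer $m\ge1$, $m_p$ is the largest power of $p$ dividing $m$. *)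

(* Defs.v *)
From mathcomp Require Import all_boot all_order all_algebra all_fingroup.
From mathcomp Require Import all_solvable all_field all_character.

Set Implicit Arguments.
Unset Strict Implicit.
Unset Printing Implicit Defensive.

Import Order.TTheory GRing.Theory Num.Theory.

Local Open Scope ring_scope.

(* A class function on G is a total function on gT that is 0 outside G, so the
   condition g \in G is not redundant. *)
Definition Van (gT : finGroupType) (G : {group gT}) (xi : 'CF(G)) : {set gT} :=
  [set g in G | xi g == 0].

(* xi 1 is an element of algC. It lies in Num.nat when xi is a character
   (Cnat_char1), and truncn then returns that natural number. *)
Definition chardeg (gT : finGroupType) (G : {group gT}) (xi : 'CF(G)) : nat :=
  Num.truncn (xi 1%g).

(* Main.v *)
Require Import Defs.
From mathcomp Require Import all_boot all_order all_algebra all_fingroup.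
From mathcomp Require Import all_solvable all_field all_character.
From mathcomp Require Import zify ring.

Set Implicit Arguments.
Unset Strict Implicit.
Unset Printing Implicit Defensive.

Import Order.TTheory GRing.Theory Num.Theory.

Local Open Scope ring_scope.

(** A vector b of n distinct non-negative integers with sum n + 'C(n, 2) is a
partition of n in disguise: its entries are the occupied positions (beads) of an
abacus.  Frobenius' formula attaches to it a class function [frob b] of the
symmetric group, which is an irreducible character up to sign, and every
irreducible character arises so ([irr_frob]).  By the Murnaghan--Nakayama rule,
the value of [frob b] at a permutation with cycle lengths r_1, r_2, ... is a
signed count [mn b] of the ways to move beads down by r_1, then r_2, ... until
the positions 0, ..., n - 1 are filled.

For q > 0 let W_q(b) be the q-weight of b ([weight]), the largest number of
successive moves of length q.  The argument compares weights at powers of p.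

- A move of length r divisible by q lowers W_q by exactly r / q.  Hence if
  the character of b does not vanish at a p-element, then W_(p^i)(b) is at least
  the sum of p^(k-i) over the cycles of length p^k with k >= i
  ([mn_weight_ge]).

- For every c there is a p-element at which the character of c does not vanish
  and all these inequalities are equalities ([mn_weight_eq]).  It is found
  greedily: exhaust the moves of the largest power of p, then those of the next
  one, and so on.  Nothing cancels, because beads that are congruent mod q never
  overtake each other, so that all ways to exhaust the moves of length q
  end with the same vector and hence with the same sign ([mn_core]).

- The degree formula n! prod_(i<j) (b_j - b_i) / prod_i b_i! shows that
  v_p(chi(1)) = v_p(n!) - sum_(i>=1) W_(p^i)(b) ([logn_mn_ones]).

Let now b and c belong to chi and psi, and take the element of the second point
for c; up to conjugacy it lies in P.  There psi does not vanish, so chi does not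
vanish either, and the first point yields W_(p^i)(c) <= W_(p^i)(b) for all i.  The
third point turns this into the inequality between the p-parts of the degrees.

The parametrisation of the irreducible characters rests on three facts: [frob b]
is a virtual character, as an integral combination of permutation characters
([frob_vchar]); it has norm one, by a counting form of Cauchy's determinant
identity ([comp_sum_alt], [frob_norm]); and no irreducible character is
orthogonal to all the [frob b] ([frob_exhaust]). *)

(** * The abacus and the Murnaghan--Nakayama rule *)

Lemma sum_neq0 (I : finType) (R : nmodType) (F : I -> R) :
  \sum_i F i != 0 -> exists i, F i != 0.
Proof.
move=> sF; apply/existsP; apply: contraNT sF => /existsPn F0.
by rewrite big1 // => i _; apply/eqP; rewrite -[_ == _]negbK F0.
Qed.

Section Abacus.

Variable m : nat.
Local Notation vec := {ffun 'I_m -> int}.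
Implicit Types (b v : vec) (s : 'S_m) (q r : nat).

Definition unitv (i : 'I_m) : vec := [ffun k => (k == i)%:Z].

Lemma sub_unitvE b i r k : (b - unitv i *+ r) k = b k - ((k == i) * r)%N%:Z.
Proof. by rewrite !ffunE ffunMnE !ffunE; case: (k == i) => /=; lia. Qed.

Definition permv s v : vec := [ffun i => v (s i)].

(** The coefficient of x^v in the Vandermonde alternant: the sign of v if v is a
permutation of 0, ..., m - 1, and 0 otherwise. *)
Definition alt v : int := \det (\matrix_(i < m, j < m) (v i == j%:Z)%:R).

Lemma alt_permv s v : alt (permv s v) = (-1) ^+ s * alt v.
Proof.
rewrite /alt -det_perm -det_mulmx -row_permE; congr (\det _).
by apply/matrixP=> i j; rewrite !mxE ffunE.
Qed.

Lemma alt_perm s : alt [ffun i => (s i)%:Z] = (-1) ^+ s.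
Proof.
rewrite /alt -det_perm; congr (\det _).
by apply/matrixP=> i j; rewrite !mxE !ffunE eqz_nat.
Qed.

Lemma alt_neq0 v : alt v != 0 -> exists s, v = [ffun i => (s i : nat)%:Z].
Proof.
move=> /sum_neq0[s]; rewrite mulf_eq0 negb_or => /andP[_ /prodf_neq0 v_s].
exists s; apply/ffunP=> i; rewrite ffunE; have:= v_s i isT.
by rewrite mxE; case: (v i =P _).
Qed.

(** The recursion of the Murnaghan--Nakayama rule: each r of the list is the length
of a cycle, and some bead is moved down by r.  Moves onto an occupied or a
negative position need not be excluded, since [alt] kills them in the end; the
sign of a rim hook, which depends on its height, is likewise left to [alt]. *)
Fixpoint mn b (rs : seq nat) : int :=
  if rs is r :: rs' then \sum_i mn (b - unitv i *+ r) rs' else alt b.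

Lemma mn_permv s b rs : mn (permv s b) rs = (-1) ^+ s * mn b rs.
Proof.
elim: rs b => [|r rs IH] b /=; first exact: alt_permv.
rewrite mulr_sumr [RHS](reindex_inj (@perm_inj _ s)); apply: eq_bigr => i _.
rewrite -IH; congr (mn _ _); apply/ffunP=> k.
by rewrite sub_unitvE !ffunE ffunMnE !ffunE (inj_eq perm_inj); case: (k == i) => /=; lia.
Qed.

Definition beads b := injective b /\ forall i, 0 <= b i.

Lemma alt_supp v : alt v != 0 ->
  (forall i, 0 <= v i) /\ \sum_i v i = 'C(m, 2)%:Z.
Proof.
case/alt_neq0=> s ->; split=> [i|]; first by rewrite ffunE.
rewrite -bin2_sum big_mkord (big_morph _ PoszD (erefl _)).
rewrite [in RHS](reindex_inj (@perm_inj _ s)) //.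
by apply: eq_bigr => i _; rewrite ffunE.
Qed.

Lemma sum_sub_unitv b i r : \sum_k (b - unitv i *+ r) k = \sum_k b k - r%:Z.
Proof.
under eq_bigr do rewrite sub_unitvE.
rewrite sumrB; congr (_ - _); rewrite (bigD1 i) //= eqxx mul1n big1 ?addr0 //.
by move=> k /negbTE->.
Qed.

(** Two equal entries give 0 because [mn] is alternating; a negative entry stays
negative under all moves. *)
Lemma mn_supp b rs : mn b rs != 0 ->
  beads b /\ \sum_i b i = (sumn rs + 'C(m, 2))%N%:Z.
Proof.
move=> nz; split; last first.
  elim: rs b nz => [|r rs IH] b /=; first by case/alt_supp=> _ ->.
  case/sum_neq0=> i /IH /eqP; rewrite sum_sub_unitv subr_eq => /eqP->.
  by rewrite -PoszD addnC addnA.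
split.
  move=> i k bik; apply/eqP; apply: contraNT nz => ik.
  have b_t : permv (tperm i k) b = b.
    by apply/ffunP=> l; rewrite ffunE; case: tpermP => // ->.
  by have := mn_permv (tperm i k) b rs; rewrite b_t odd_tperm ik expr1 mulN1r; lia.
elim: rs b nz => [|r rs IH] b /=; first by case/alt_supp.
case/sum_neq0=> i /IH b0 k; apply: le_trans (b0 k) _.
by rewrite sub_unitvE; lia.
Qed.

(** * Hook weights and cores *)

(** The number of beads below bead i on its runner, the runners being the residue
classes mod q. *)
Definition below q b i := #|[set k | (q %| b i - b k)%Z && (b k < b i)]|.

(** When the entries of b are distinct and non-negative, this is the number of hooks
of length divisible by q of the partition of b.  It is written
as a difference which makes sense for every vector, so that the effect of a move
([weight_sub]) needs no condition, and which is the form that the degree formula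
produces. *)
Definition weight q b : int :=
  \sum_i (b i %/ q)%Z - \sum_(i < m) \sum_(k < m | (k < i)%N) (q %| b i - b k)%Z%:Z.

Lemma sub_unitv_mulE b i c q k :
  (b - unitv i *+ (c * q)) k = (- (((k == i) * c)%N%:Z)) * q%:Z + b k.
Proof. by rewrite sub_unitvE mulnA PoszM mulNr addrC. Qed.

Lemma dvdz_sub_unitv b i c q k l :
  (q %| (b - unitv i *+ (c * q)%N) k - (b - unitv i *+ (c * q)%N) l)%Z
    = (q %| b k - b l)%Z.
Proof.
rewrite !sub_unitv_mulE opprD addrACA -mulrBl.
by rewrite dvdzE -dvdzE rpredDl // dvdz_mull.
Qed.

Lemma weight_sub q b i r : (0 < q)%N -> (q %| r)%N ->
  weight q (b - unitv i *+ r) = weight q b - (r %/ q)%N%:Z.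
Proof.
move=> q0 /dvdnP[c ->]; rewrite mulnK // /weight.
under eq_bigr do rewrite sub_unitv_mulE divzMDl ?lt0n_neq0 ?eqz_nat -?lt0n //.
rewrite addrAC big_split /= addrC; congr (_ + _ - _).
  rewrite (bigD1 i) //= eqxx mul1n big1 ?addr0 // => k /negbTE->.
  by rewrite mul0n oppr0.
by apply: eq_bigr => k _; apply: eq_bigr => l _; rewrite dvdz_sub_unitv.
Qed.

(** Of two congruent beads exactly one is below the other, which turns the sum over
pairs into a sum over beads. *)
Lemma weightE q b : (0 < q)%N -> injective b ->
  weight q b = \sum_i ((b i %/ q)%Z - (below q b i)%:Z).
Proof.
move=> q0 inj_b; rewrite sumrB; congr (_ - _).
pose T i k : int := ((q %| b i - b k)%Z && (b k < b i))%:Z.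
transitivity (\sum_(i < m) \sum_(k < m | (k < i)%N) (T i k + T k i)).
  apply: eq_bigr => i _; apply: eq_bigr => k ki; rewrite /T -(opprB (b i) (b k)) rpredN.
  have /eqP : b i != b k by rewrite (inj_eq inj_b) neq_ltn ki orbT.
  by case: (_ %| _)%Z => //=; lia.
transitivity (\sum_i \sum_k T i k); last first.
  apply: eq_bigr => i _; rewrite /below cardsE -sum1_card (big_morph _ PoszD (erefl _)).
  by rewrite [RHS]big_mkcond; apply: eq_bigr => k _; rewrite unfold_in /T; case: (_ && _).
under eq_bigr do rewrite big_split /=.
rewrite big_split /= [X in _ + X](exchange_big_dep xpredT) //= -big_split /=.
apply: eq_bigr => i _; have Tii : T i i = 0 by rewrite /T ltxx andbF.
rewrite [RHS](bigD1 i) //= Tii add0r.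
rewrite [RHS](bigID (fun k : 'I_m => (k < i)%N)) /=; congr (_ + _).
  by apply: eq_bigl => k; case: ltngtP => //; rewrite -val_eqE /=; case: ltngtP.
by apply: eq_bigl => k; rewrite -val_eqE /=; case: ltngtP.
Qed.

(** The beads below bead i on its runner have distinct quotients by q, all smaller
than that of b i. *)
Lemma below_le q b i : (0 < q)%N -> beads b -> (below q b i)%:Z <= (b i %/ q)%Z.
Proof.
move=> q0 [inj_b b0].
have d0 k : (b k %/ q)%Z = `|(b k %/ q)%Z|%N by rewrite gez0_abs ?divz_ge0.
rewrite d0 lez_nat /below -[X in (_ <= X)%N]card_ord.
have lt_div (k : {k | (q %| b i - b k)%Z && (b k < b i)}) :
    (`|(b (val k) %/ q)%Z| < `|(b i %/ q)%Z|)%N.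
  case: k => k /= /andP[/dvdzP[t bik] ltki].
  rewrite -ltz_nat -!d0.
  have -> : b i = t * q%:Z + b k by lia.
  rewrite divzMDl; last by lia.
  have : 0 < t by nia.
  lia.
rewrite cardsE -card_sig; apply: (@leq_card _ _ (fun k => Ordinal (lt_div k))).
move=> [k pk] [l pl] /(congr1 val) /= ekl; apply/val_inj/inj_b => /=.
have {ekl} : (b k %/ q)%Z = (b l %/ q)%Z by rewrite (d0 k) ekl -d0.
case/andP: pk => /dvdzP[t bik] _; case/andP: pl => /dvdzP[u bil] _.
have -> : b k = (u - t) * q%:Z + b l by lia.
rewrite divzMDl; last by lia.
move=> e; have -> : u - t = 0 by lia.
by rewrite mul0r add0r.
Qed.

Lemma weight_ge0 q b : (0 < q)%N -> beads b -> 0 <= weight q b.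
Proof.
move=> q0 bb; rewrite weightE //; last by case: bb.
by apply: sumr_ge0 => i _; rewrite subr_ge0 below_le.
Qed.

(** The vector reached by pushing down all the beads of each runner while preserving
their order. *)
Definition core q b : vec := [ffun i => (b i %% q)%Z + (below q b i * q)%N%:Z].

Lemma weight0_core q b : (0 < q)%N -> beads b -> weight q b = 0 -> core q b = b.
Proof.
move=> q0 bb; rewrite weightE //; last by case: bb.
move/eqP; rewrite psumr_eq0 => [/allP w0|i _]; last by rewrite subr_ge0 below_le.
apply/ffunP=> i; rewrite ffunE [RHS](divz_eq _ q) addrC PoszM; congr (_ * _ + _).
by have := w0 i (mem_index_enum i); rewrite /= subr_eq0 => /eqP->.
Qed.

(** A legal move does not overtake a congruent bead, since the next lower position
on the runner is the one that gets occupied. *)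
Lemma core_move q b i : (0 < q)%N -> injective b ->
  injective (b - unitv i *+ q) -> core q (b - unitv i *+ q) = core q b.
Proof.
move=> q0 inj_b inj_b'; apply/ffunP=> k; rewrite [LHS]ffunE [RHS]ffunE.
have -> : unitv i *+ q = unitv i *+ (1 * q) by rewrite mul1n.
have -> : ((b - unitv i *+ (1 * q)) k %% q)%Z = (b k %% q)%Z.
  by rewrite sub_unitv_mulE modzMDl.
congr (_ + (_ * _)%N%:Z); apply: eq_card => l; rewrite !inE dvdz_sub_unitv.
apply: andb_id2l => /dvdzP[t]; rewrite mul1n !sub_unitvE.
have [->|nl] := eqVneq l i; have [->|nk] := eqVneq k i => //=; try by lia.
- move=> bki; have bk : b k <> b i by move/inj_b/eqP; apply/negP.
  have bk' : b k <> b i - q%:Z.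
    move=> e; have /inj_b'/eqP : (b - unitv i *+ q) k = (b - unitv i *+ q) i.
      by rewrite !sub_unitvE eqxx (negbTE nk) /=; lia.
    exact/negP.
  have t0 : t <> 0 by move=> e; apply: bk; rewrite e in bki; lia.
  have t1 : t <> -1 by move=> e; apply: bk'; rewrite e in bki; lia.
  have [] : t <= -2 \/ 1 <= t by lia.
    move=> ?; have : t * q%:Z <= -2 * q%:Z by nia.
    lia.
  move=> ?; have : 1 * q%:Z <= t * q%:Z by nia.
  lia.
- move=> bil; have bl : b l <> b i by move/inj_b/eqP; apply/negP.
  have bl' : b l <> b i - q%:Z.
    move=> e; have /inj_b'/eqP : (b - unitv i *+ q) l = (b - unitv i *+ q) i.
      by rewrite !sub_unitvE eqxx (negbTE nl) /=; lia.
    exact/negP.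
  have t0 : t <> 0 by move=> e; apply: bl; rewrite e in bil; lia.
  have t1 : t <> 1 by move=> e; apply: bl'; rewrite e in bil; lia.
  have [] : t <= -1 \/ 2 <= t by lia.
    move=> ?; have : t * q%:Z <= -1 * q%:Z by nia.
    lia.
  move=> ?; have : 2 * q%:Z <= t * q%:Z by nia.
  lia.
Qed.

(** If no bead can move, then all the positions below a bead on its runner are
occupied, and every summand of [weightE] is at most 0. *)
Lemma exists_move q b : (0 < q)%N -> beads b -> 0 < weight q b ->
  exists i, beads (b - unitv i *+ q).
Proof.
move=> q0 [inj_b b0] w0.
have [/existsP[i /andP[qi /forallP ni]]|/existsPn no_move] :=
  boolP [exists i, (q%:Z <= b i) && [forall k, b k != b i - q%:Z]].
  exists i; split=> [k l|k]; rewrite !sub_unitvE.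
    have := ni k; have := ni l.
    have [->|nk] := eqVneq k i; have [->|nl] := eqVneq l i => //=; try lia.
    by rewrite !subr0; move=> _ _ /inj_b.
  by have [->|_] := eqVneq k i; have := b0 k; rewrite /=; lia.
suff: weight q b <= 0 by lia.
rewrite weightE //; apply: sumr_le0 => i _; rewrite subr_le0.
have step t : t%:Z <= (b i %/ q)%Z -> exists k, b k = b i - (t * q)%N%:Z.
  elim: t => [|t IH] lt_t; first by exists i; lia.
  have [|k bk] := IH; first by lia.
  have := no_move k; rewrite negb_and negb_forall => /orP[|/existsP[l]].
    have qz : q%:Z != 0 by lia.
    have := divz_eq (b i) q; have := modz_ge0 (b i) qz.
    have := ler_wpM2r (ler0n int q) lt_t; rewrite natz bk; lia.
  by rewrite negbK => /eqP bl; exists l; lia.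
pose N := `|(b i %/ q)%Z|%N.
have dN : (b i %/ q)%Z = N by rewrite gez0_abs ?divz_ge0.
have /fin_all_exists[f bf] (t : 'I_N) : exists k, b k = b i - (t.+1 * q)%N%:Z.
  by apply: step; rewrite dN lez_nat.
rewrite dN lez_nat -[N in (N <= _)%N]card_ord -(@card_imset _ _ f).
  apply/subset_leq_card/subsetP=> _ /imsetP[t _ ->]; rewrite inE bf.
  by rewrite subKr; apply/andP; split; [apply/dvdzP; exists t.+1%:Z; rewrite PoszM|nia].
move=> t u /(congr1 b); rewrite !bf => e; apply: val_inj => /=; nia.
Qed.

Lemma beadsP b : reflect (beads b) (injectiveb b && [forall i, 0 <= b i]).
Proof. by apply: (iffP andP) => -[/injectiveP ? /forallP]. Qed.

(** All the sequences of w moves of length q end at [core q b], as a vector and not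
only up to a permutation.  They therefore contribute with the same sign, and N
counts them. *)
Lemma mn_core q b w : (0 < q)%N -> beads b -> weight q b = w%:Z ->
  [/\ beads (core q b), weight q (core q b) = 0,
      (forall q', (0 < q')%N -> (q' %| q)%N ->
         weight q' b = weight q' (core q b) + (w * (q %/ q'))%N%:Z)
    & exists2 N : int, 0 < N
      & forall rs, mn b (nseq w q ++ rs) = N * mn (core q b) rs].
Proof.
move=> q0; elim: w b => [|w IH] b bb wb.
  rewrite weight0_core //; split=> // [q' _ _|]; first by rewrite addr0.
  by exists 1 => // rs; rewrite mul1r.
have weight_move i q' : (0 < q')%N -> (q' %| q)%N ->
    weight q' (b - unitv i *+ q) = weight q' b - (q %/ q')%N%:Z.
  by move=> ? ?; rewrite weight_sub.
have [|i bi] := exists_move q0 bb; first by rewrite wb.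
have{IH} Hi k : beads (b - unitv k *+ q) ->
   [/\ beads (core q b), weight q (core q b) = 0,
      (forall q', (0 < q')%N -> (q' %| q)%N ->
         weight q' b = weight q' (core q b) + (w.+1 * (q %/ q'))%N%:Z)
    & exists2 N : int, 0 < N
      & forall rs, mn (b - unitv k *+ q) (nseq w q ++ rs) = N * mn (core q b) rs].
  move=> bbi; have [inj_b _] := bb; have [inj_bi _] := bbi.
  have := IH _ bbi; rewrite core_move // weight_move // wb divnn q0.
  case; first by lia.
  move=> ? ? Hw ?; split=> // q' q'0 q'q.
  by have := Hw q' q'0 q'q; rewrite weight_move // mulSn; lia.
have [core_b core_w core_w' _] := Hi i bi; split=> //.
have /fin_all_exists[N HN] k : exists N : int, [/\ 0 <= N, beads (b - unitv k *+ q) -> 0 < N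
    & forall rs, mn (b - unitv k *+ q) (nseq w q ++ rs) = N * mn (core q b) rs].
  have [/beadsP bk|/beadsP bk] := boolP (injectiveb (b - unitv k *+ q)
      && [forall l, 0 <= (b - unitv k *+ q) l]).
    by have [_ _ _ [N N0 HN]] := Hi k bk; exists N; split=> //; apply: ltW.
  exists 0; split=> // rs; rewrite mul0r; apply/eqP.
  by case: eqP => // /eqP /mn_supp[/bk].
exists (\sum_k N k) => [|rs].
  rewrite (bigD1 i) //=; apply: ltr_wpDr.
    by apply: sumr_ge0 => k _; have [] := HN k.
  by have [_ + _] := HN i; apply.
by rewrite /= mulr_suml; apply: eq_bigr => k _; have [_ _ ->] := HN k.
Qed.

End Abacus.

(** * Extremal prime-power cycle types *)

Section HookRemoval.

Variables (m p : nat) (p_gt1 : (1 < p)%N).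
Local Notation vec := {ffun 'I_m -> int}.
Implicit Types (b : vec) (e : seq nat).

Definition pparts e := [seq (p ^ k)%N | k <- e].

(** The number of moves of length p^i to which the moves of lengths p^k, k in e,
amount, the shorter ones counting for nothing. *)
Definition hooks i e := (\sum_(k <- e | (i <= k)%N) p ^ (k - i))%N.

(** As the exponents decrease, the cycles whose length is divisible by p^i come
first; each lowers the p^i-weight by p^(k-i), and what remains is
non-negative. *)
Lemma mn_weight_ge i b e : sorted geq e -> mn b (pparts e) != 0 ->
  (hooks i e)%:Z <= weight (p ^ i) b.
Proof.
have pi0 : (0 < p ^ i)%N by rewrite expn_gt0 ltnW.
elim: e b => [|k e IH] b /=.
  by move=> _ /(@mn_supp _ _ [::])[? _]; rewrite /hooks big_nil weight_ge0.
move=> k_e nz; rewrite /hooks big_cons; case: leqP => [ik|ki].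
  have [l /(IH _ (path_sorted k_e))] := sum_neq0 nz.
  by rewrite weight_sub ?dvdn_exp2l // -expnB ?(ltnW p_gt1) // -/(hooks i e); lia.
rewrite big1_seq => [|j /andP[ij je]].
  by apply: weight_ge0; have [] := @mn_supp _ _ (p ^ k :: pparts e)%N nz.
have /allP/(_ j je) := order_path_min (rev_trans leq_trans) k_e.
by rewrite /= leqNgt (leq_trans ki ij).
Qed.

(** A vector of 1-weight 0 is its own 1-core, whose i-th entry is the number of
entries below it; this is a permutation of 0, ..., m - 1. *)
Lemma alt_core b : beads b -> weight 1 b = 0 -> alt b != 0.
Proof.
move=> bb /(weight0_core (ltn0Sn 0) bb) core_b; have [inj_b _] := bb.
have b_lt i : (below 1 b i < m)%N.
  rewrite -[X in (_ < X)%N]card_ord; apply/proper_card/properP.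
  by split; [apply/subsetP | exists i; rewrite ?inE ?ltxx ?andbF].
have bE i : b i = Ordinal (b_lt i) by rewrite -[in LHS]core_b ffunE modz1 muln1.
have inj_f : injective (fun i => Ordinal (b_lt i)).
  by move=> i k /(congr1 (fun x : 'I_m => x%:Z)); rewrite -!bE => /inj_b.
suff -> : b = [ffun i => (perm inj_f i)%:Z] by rewrite alt_perm signr_eq0.
by apply/ffunP=> i; rewrite ffunE permE bE.
Qed.

(** Exhaust the moves of length p^j, pass to the core, and continue with p^(j-1).  The
p^i-weight of the core for i <= j has dropped by the contribution of the
cycles used so far. *)
Lemma mn_weight_eq j b : beads b -> exists e,
  [/\ sorted geq e, all (fun k => k <= j)%N e, mn b (pparts e) != 0
    & forall i, (i <= j)%N -> weight (p ^ i) b = (hooks i e)%:Z].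
Proof.
have p0 k : (0 < p ^ k)%N by rewrite expn_gt0 ltnW.
have sorted_nseq w k e : sorted geq e -> all (fun k' => k' <= k)%N e ->
    sorted geq (nseq w k ++ e).
  elim: w => //= w IH /[dup] se /IH + /[dup] le_e => /[apply].
  rewrite path_sortedE ?all_cat ?all_nseq; last exact: rev_trans leq_trans.
  by move=> ->; rewrite /= leqnn orbT andbT.
have hooks_nseq w k e i : (i <= k)%N -> hooks i (nseq w k ++ e)
    = (w * p ^ (k - i) + hooks i e)%N.
  move=> ik; rewrite /hooks big_cat big_mkcond /= big_nseq ik.
  by rewrite iter_addn_0 mulnC.
elim: j b => [|j IH] b bb.
  have w_b : weight (p ^ 0) b = `|weight (p ^ 0) b|%N by rewrite gez0_abs ?weight_ge0.
  have [bc wc w' [N N0 HN]] := mn_core (p0 0%N) bb w_b.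
  set w := `|_|%N in w_b w' HN; exists (nseq w 0%N); split.
  - by rewrite -[nseq _ _]cats0; apply: sorted_nseq.
  - by rewrite all_nseq orbT.
  - rewrite /pparts map_nseq -[nseq _ _]cats0 HN mulf_neq0 //; first by rewrite gt_eqF.
    exact: alt_core.
  - move=> i; rewrite leqn0 => /eqP->; rewrite w_b -[nseq _ _]cats0 hooks_nseq //.
    by rewrite /hooks big_nil addn0 muln1.
have w_b : weight (p ^ j.+1) b = `|weight (p ^ j.+1) b|%N.
  by rewrite gez0_abs ?weight_ge0.
have [bc wc w' [N N0 HN]] := mn_core (p0 j.+1) bb w_b.
set w := `|_|%N in w_b w' HN; have [e [se le_e nz_e we]] := IH _ bc.
have le_e' : all (fun k => k <= j.+1)%N e.
  by apply: sub_all le_e => k; apply: leqW.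
exists (nseq w j.+1 ++ e); split.
- exact: sorted_nseq.
- by rewrite all_cat all_nseq leqnn orbT.
- by rewrite /pparts map_cat map_nseq HN mulf_neq0 // gt_eqF.
- move=> i i_j; rewrite hooks_nseq // w' ?dvdn_exp2l // -expnB ?(ltnW p_gt1) // PoszD addrC.
  congr (_ + _); move: i_j; rewrite leq_eqVlt => /predU1P[->|/we//].
  rewrite wc /hooks big1_seq // => k /andP[jk ke].
  by have := allP le_e k ke; rewrite /= leqNgt jk.
Qed.

End HookRemoval.

(** * The degree formula *)

Section Degree.

Variable m : nat.
Local Notation vec := {ffun 'I_m -> int}.
Implicit Types (b : vec) (x : int).

(** The inverse factorial, with its usual value 0 at negative integers. *)
Definition inv_fact x : rat := if x is Posz n then (n`!)%:R^-1 else 0.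

Lemma inv_factS x : x%:~R * inv_fact x = inv_fact (x - 1).
Proof.
case: x => [[|n]|n]; [by rewrite mul0r | | by rewrite mulr0].
have -> : Posz n.+1 - 1 = n by lia.
by rewrite /inv_fact factS natrM invfM mulrA -pmulrn divff ?mul1r // pnatr_eq0.
Qed.

(** Up to sign, the determinantal formula for f^lambda / n!, where f^lambda is the
number of standard tableaux. *)
Definition dim_det b : rat := \det (\matrix_(i < m, j < m) inv_fact (b i - j%:Z)).

Lemma dim_detE b :
  dim_det b = \sum_(s : 'S_m) (-1) ^+ s * \prod_i inv_fact (b i - (s i)%:Z).
Proof.
by apply: eq_bigr => s _; congr (_ * _); apply: eq_bigr => i _; rewrite mxE.
Qed.

(** In the s-th term of the Leibniz formula, lowering b i multiplies the factor of row
i by b i - s i, and the sum over i of these numbers does not depend on s. *)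
Lemma dim_det_branch b :
  \sum_i dim_det (b - unitv i *+ 1) = (\sum_i b i - 'C(m, 2)%:Z)%:~R * dim_det b.
Proof.
under eq_bigr do rewrite dim_detE; rewrite exchange_big dim_detE mulr_sumr /=.
apply: eq_bigr => s _; rewrite -mulr_sumr mulrCA; congr (_ * _).
have -> : \sum_i b i - 'C(m, 2)%:Z = \sum_i (b i - (s i)%:Z).
  rewrite sumrB; congr (_ - _); rewrite -bin2_sum big_mkord.
  by rewrite (big_morph _ PoszD (erefl _)) (reindex_inj (@perm_inj _ s)).
rewrite rmorph_sum /= mulr_suml; apply: eq_bigr => i _.
rewrite (bigD1 i) //= [in RHS](bigD1 i) //= mulrA inv_factS sub_unitvE eqxx.
congr (inv_fact _ * _); first by lia.
by apply: eq_bigr => k /negbTE ki; rewrite sub_unitvE ki subr0.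
Qed.

(** Both sides satisfy the same recursion, by [dim_det_branch]; for n = 0 the
sums force all the arguments of [inv_fact] to vanish in a nonzero term. *)
Lemma mn_ones n b : \sum_i b i = (n + 'C(m, 2))%N%:Z ->
  (mn b (nseq n 1%N))%:~R = (n`!)%:R * dim_det b.
Proof.
elim: n b => [|n IH] b sum_b /=.
  rewrite mul1r dim_detE /alt rmorph_sum /=.
  apply: eq_bigr => s _; rewrite rmorphM /= rmorph_sign; congr (_ * _).
  rewrite rmorph_prod /=.
  have [b_s|nb] := boolP [forall i, b i == (s i)%:Z].
    by apply: eq_bigr => i _; rewrite mxE (eqP (forallP b_s i)) eqxx subrr /= invr1.
  have [i bi] : exists i, b i < s i.
    apply/existsP; apply: contraR nb => /existsPn b_s.
    have le_s i : 0 <= b i - (s i)%:Z by have := b_s i; lia.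
    have /eqP : \sum_i (b i - (s i)%:Z) = 0.
      rewrite sumrB sum_b add0n -bin2_sum big_mkord.
      by rewrite (big_morph _ PoszD (erefl _)) [X in X - _](reindex_inj (@perm_inj _ s)) subrr.
    rewrite psumr_eq0 // => /allP s0; apply/forallP=> i.
    by have := s0 i (mem_index_enum i); rewrite /= subr_eq0.
  rewrite (bigD1 i) //= mxE lt_eqF //= mul0r (bigD1 i) //=.
  suff -> : inv_fact (b i - (s i)%:Z) = 0 by rewrite mul0r.
  by move: bi; rewrite -subr_lt0; case: (b i - _).
rewrite rmorph_sum /=.
under eq_bigr => i _.
  rewrite IH; first over.
  by rewrite sum_sub_unitv sum_b; lia.
rewrite -mulr_sumr dim_det_branch sum_b factS natrM mulrA; congr (_ * _).
have -> : (n.+1 + 'C(m, 2))%N%:Z - 'C(m, 2)%:Z = n.+1 by lia.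
by rewrite mulrC -pmulrn.
Qed.

Lemma fact_inv_fact (a j : nat) :
  (a`!)%:R * inv_fact (a%:Z - j%:Z) = \prod_(k < j) (a%:R - k%:R).
Proof.
elim: j => [|j IH]; first by rewrite big_ord0 subr0 /= divff // pnatr_eq0 -lt0n fact_gt0.
rewrite big_ord_recr /= -IH -mulrA; congr (_ * _).
have -> : a%:Z - j.+1%:Z = (a%:Z - j%:Z) - 1 by lia.
by rewrite -inv_factS mulrC rmorphB.
Qed.

(** The coefficient matrix of the polynomials is unitriangular, so the determinant is
the Vandermonde one. *)
Lemma det_monic (R : comNzRingType) (P : nat -> {poly R}) (x : 'I_m -> R) :
    (forall j, P j \is monic) -> (forall j, size (P j) = j.+1) ->
  \det (\matrix_(i < m, j < m) (P j).[x i])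
    = \prod_(i < m) \prod_(j < m | (i < j)%N) (x j - x i).
Proof.
move=> mon_P size_P.
pose C := \matrix_(j < m, l < m) (P j)`_l.
have detC : \det C = 1.
  rewrite det_trig => [|]; last first.
    by apply/is_trig_mxP=> i j ij; rewrite mxE nth_default // size_P.
  rewrite big1 // => i _; rewrite mxE.
  by have /monicP := mon_P i; rewrite lead_coefE size_P.
transitivity (\det ((Vandermonde m (\row_i x i))^T *m C^T)).
  congr (\det _); apply/matrixP=> i j; rewrite !mxE horner_coef size_P.
  rewrite (big_ord_widen m (fun l => (P j)`_l * x i ^+ l)) // big_mkcond /=.
  apply: eq_bigr => l _; rewrite !mxE mulrC; case: ltnP => // jl.
  by rewrite nth_default ?size_P // mulr0.
rewrite det_mulmx !det_tr detC mulr1 det_Vandermonde.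
by apply: eq_bigr => i _; apply: eq_bigr => j _; rewrite !mxE.
Qed.

(** Frobenius' degree formula: multiplying row i of [dim_det] by (b i)! gives
the values at b i of the falling factorial polynomials, which are monic. *)
Lemma mn_ones_prod n b : (forall i, 0 <= b i) -> \sum_i b i = (n + 'C(m, 2))%N%:Z ->
  mn b (nseq n 1%N) * \prod_i (`|b i|`!)%:Z
    = (n`!)%:Z * \prod_(i < m) \prod_(j < m | (i < j)%N) (b j - b i).
Proof.
move=> b0 sum_b; apply: (@intr_inj rat); rewrite !rmorphM /= mn_ones //.
rewrite -!mulrA; congr (_ * _).
pose P j : {poly rat} := \prod_(k < j) ('X - (k%:R)%:P).
have -> : (\prod_(i < m) \prod_(j < m | (i < j)%N) (b j - b i))%:~R
    = \det (\matrix_(i < m, j < m) (P j).[(b i)%:~R]).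
  rewrite (@det_monic _ P (fun i => (b i)%:~R)) => [|j|j].
  - rewrite rmorph_prod; apply: eq_bigr => i _.
    by rewrite rmorph_prod; apply: eq_bigr => j _; rewrite rmorphB.
  - exact: monic_prod_XsubC.
  - by rewrite size_prod_XsubC /index_enum -enumT size_enum_ord.
rewrite rmorph_prod /= dim_detE mulr_suml.
apply: eq_bigr => s _; rewrite -mulrA -big_split /=; congr (_ * _).
apply: eq_bigr => i _; rewrite mxE horner_prod mulrC.
case: (b i) (b0 i) => // a _; rewrite -!pmulrn fact_inv_fact.
by apply: eq_bigr => k _; rewrite hornerXsubC.
Qed.

End Degree.

(** * The p-part of the degree *)

Section DegreeValuation.

Variables (p : nat) (p_pr : prime p).
Let p_gt1 := prime_gt1 p_pr.

Lemma absz_prod (I : Type) (r : seq I) (Q : pred I) (F : I -> int) :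
  `|(\prod_(i <- r | Q i) F i)%R|%N = (\prod_(i <- r | Q i) `|F i|)%N.
Proof. exact: (big_morph absz abszM (erefl _)). Qed.

Lemma logn_prod (I : Type) (r : seq I) (Q : pred I) (F : I -> nat) :
    (forall i, Q i -> 0 < F i)%N ->
  logn p (\prod_(i <- r | Q i) F i) = (\sum_(i <- r | Q i) logn p (F i))%N.
Proof.
move=> F0; elim: r => [|i r IH]; first by rewrite !big_nil logn1.
rewrite !big_cons; case: ifP => // Qi.
by rewrite lognM ?F0 // ?IH //; apply: prodn_cond_gt0.
Qed.

Lemma sum_nat_vanish (a b : nat) (F : nat -> nat) :
    (forall k, minn a b <= k -> F k = 0)%N ->
  (\sum_(1 <= k < a) F k = \sum_(1 <= k < b) F k)%N.
Proof.
wlog ab : a b / (a <= b)%N => [hw F0|].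
  by case: (leqP a b) => [|/ltnW] ab; [|symmetry]; apply: hw => // k; rewrite minnC; apply: F0.
rewrite (minn_idPl ab) => F0; case: (leqP 1 a) => [a0|].
  rewrite (big_cat_nat a0 ab) /= [X in (_ + X)%N]big1_seq ?addn0 // => k.
  by rewrite mem_index_iota => /andP[_ /andP[/F0]].
rewrite ltnS leqn0 => /eqP a0; rewrite [LHS]big_geq ?a0 //.
by rewrite big1 // => k _; apply: F0; rewrite a0.
Qed.

Lemma logn_fact_trunc J x : (x < p ^ J)%N ->
  logn p x`! = (\sum_(1 <= k < J.+1) x %/ p ^ k)%N.
Proof.
move=> xJ; rewrite logn_fact //; apply: sum_nat_vanish => k.
rewrite geq_min => /orP[] /ltnW le_k; rewrite divn_small //.
  exact: leq_ltn_trans le_k (ltn_expl _ p_gt1).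
by apply: leq_trans xJ _; rewrite leq_exp2l.
Qed.

Lemma logn_trunc J x : (0 < x)%N -> (x < p ^ J)%N ->
  logn p x = (\sum_(1 <= k < J.+1) (p ^ k %| x))%N.
Proof.
move=> x0 xJ; rewrite logn_count_dvd //; apply: sum_nat_vanish => k.
rewrite geq_min => le_k; apply/eqP; rewrite eqb0; apply/negP=> /(dvdn_leq x0).
apply/negP; rewrite -ltnNge; case/orP: le_k => [le_k|/ltnW le_k].
  exact: leq_ltn_trans le_k (ltn_expl _ p_gt1).
by apply: leq_trans xJ _; rewrite leq_exp2l.
Qed.

(** Legendre's formula for the factorials, and the analogous count for the differences
of beads, produce the two sums in the definition of [weight]. *)
Lemma logn_mn_ones m J n (b : {ffun 'I_m -> int}) :
    beads b -> \sum_i b i = (n + 'C(m, 2))%N%:Z -> (forall i, `|b i| < p ^ J)%N ->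
  (logn p `|mn b (nseq n 1%N)|)%:Z + \sum_(1 <= k < J.+1) weight (p ^ k) b
    = (logn p n`!)%:Z.
Proof.
move=> [inj_b b0] sum_b bJ.
have diff_gt0 (i j : 'I_m) : (i < j)%N -> (0 < `|b j - b i|)%N.
  by move=> ij; rewrite absz_gt0 subr_eq0 (inj_eq inj_b) neq_ltn ij orbT.
have /(congr1 absz) := mn_ones_prod b0 sum_b.
rewrite !abszM !absz_prod.
under [X in _ = (_ * X)%N]eq_bigr do rewrite absz_prod.
have P0 : (0 < \prod_(i < m) \prod_(j < m | (i < j)%N) `|(b j - b i)%R|)%N.
  by apply: prodn_gt0 => i; apply: prodn_cond_gt0 => j; apply: diff_gt0.
move=> E; have mn0 : (0 < `|mn b (nseq n 1%N)|)%N.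
  rewrite lt0n; apply/eqP => mn0; move/esym/eqP: E.
  by rewrite mn0 mul0n -leqn0 leqNgt muln_gt0 absz_nat fact_gt0 P0.
move/(congr1 (logn p)): E; rewrite !lognM ?fact_gt0 //; last first.
  by apply: prodn_gt0 => i; rewrite absz_nat fact_gt0.
rewrite !logn_prod => [E|i _|i _]; last 2 first.
- by apply: prodn_cond_gt0 => j; apply: diff_gt0.
- by rewrite absz_nat fact_gt0.
have {}E : (logn p `|mn b (nseq n 1%N)| + \sum_(1 <= k < J.+1) \sum_i `|b i| %/ p ^ k
   = logn p n`! + \sum_(1 <= k < J.+1)
        \sum_(i < m) \sum_(j < m | (j < i)%N) (p ^ k %| `|(b i - b j)%R|))%N.
  rewrite exchange_big /= [X in (_ = _ + X)%N]exchange_big /=.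
  under eq_bigr do rewrite -logn_fact_trunc //.
  rewrite E; congr (_ + _)%N.
  under [RHS]eq_bigr do rewrite exchange_big /=.
  rewrite [RHS](exchange_big_dep xpredT) //=; apply: eq_bigr => i _.
  rewrite logn_prod => [|j /diff_gt0//]; apply: eq_bigr => j ij.
  apply: logn_trunc; first exact: diff_gt0.
  have := bJ i; have := bJ j; have := b0 i; have := b0 j; lia.
have -> : \sum_(1 <= k < J.+1) weight (p ^ k) b =
    (\sum_(1 <= k < J.+1) \sum_i `|b i| %/ p ^ k)%N%:Z
    - (\sum_(1 <= k < J.+1) \sum_(i < m) \sum_(j < m | (j < i)%N)
        (p ^ k %| `|(b i - b j)%R|))%N%:Z.
  rewrite !(big_morph _ PoszD (erefl _)) -sumrB; apply: eq_bigr => k _.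
  rewrite !(big_morph _ PoszD (erefl _)); congr (_ - _).
    by apply: eq_bigr => i _; rewrite -divz_nat gez0_abs.
  by apply: eq_bigr => i _; rewrite (big_morph _ PoszD (erefl _)).
lia.
Qed.

End DegreeValuation.

(** * Colourings of the points and their stabilisers *)

Section Colourings.

Variables (n : nat) (C : finType).
Local Notation colouring := {ffun 'I_n -> C}.
Implicit Types (f : colouring) (g h : 'S_n).

(** The symmetric group acts on the functions from the points to a set C of
colours; a permutation fixes a colouring when the colouring is constant on the
cycles. *)
Definition recolour f g : colouring := [ffun x => f (g x)].

Lemma recolourM f g h : recolour (recolour f g) h = recolour f (h * g)%g.
Proof. by apply/ffunP=> x; rewrite !ffunE permM. Qed.

Lemma recolour1 f : recolour f 1%g = f.
Proof. by apply/ffunP=> x; rewrite ffunE perm1. Qed.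

Lemma recolourK g : cancel (recolour^~ g) (recolour^~ g^-1%g).
Proof. by move=> f; rewrite recolourM mulVg recolour1. Qed.

Definition stab f := [set g : 'S_n | recolour f g == f].

Lemma group_set_stab f : group_set (stab f).
Proof.
apply/group_setP; split=> [|g h]; rewrite !inE ?recolour1 // => /eqP fg /eqP fh.
by rewrite -recolourM fh fg.
Qed.
Canonical stab_group f := group (group_set_stab f).

Lemma stab_gt0 f : (0 < #|stab f|)%N.
Proof. exact: (cardG_gt0 (stab_group f)). Qed.

Definition content f : {ffun C -> 'I_n.+1} := [ffun c => inord #|[pred x | f x == c]|].

Lemma contentE f c : content f c = #|[pred x | f x == c]| :> nat.
Proof. by rewrite ffunE inordK // ltnS -[X in (_ <= X)%N]card_ord max_card. Qed.

Lemma sum_content (V : nmodType) (w : C -> V) f :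
  \sum_x w (f x) = \sum_c w c *+ content f c.
Proof.
rewrite (partition_big f xpredT) //=; apply: eq_bigr => c _.
by rewrite contentE -sumr_const; apply: eq_bigr => x /eqP->.
Qed.

Lemma content_recolour f g : content (recolour f g) = content f.
Proof.
apply/ffunP=> c; rewrite !ffunE; congr inord.
rewrite -!sum1_card [RHS](reindex_inj (@perm_inj _ g)); apply: eq_bigl => x.
by rewrite !inE ffunE.
Qed.

Lemma content_inj f f' : content f = content f' -> exists g, f' = recolour f g.
Proof.
move=> eq_c.
have count_f (h : colouring) (c : C) : count_mem c [seq h x | x : 'I_n] = content h c.
  by rewrite /image_mem count_map enumT contentE cardE size_filter.
have /tuple_permP[g eq_fg] : perm_eq [seq f' x | x : 'I_n] [tuple f x | x < n].
  by apply/allP=> c _ /=; rewrite !count_f eq_c.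
exists g; apply/ffunP=> x; rewrite ffunE.
have := congr1 (fun s => nth (f x) s x) eq_fg.
rewrite (nth_map x) ?size_enum_ord // nth_ord_enum => ->.
by rewrite -[x in nth _ _ x]/(nat_of_ord x) -tnth_nth !tnth_mktuple.
Qed.

Lemma content_surj (M : {ffun C -> 'I_n.+1}) : (\sum_c M c = n)%N ->
  exists f, content f = M.
Proof.
move=> sumM; pose s := flatten [seq nseq (M c) c | c : C].
have sz_s : size s == n.
  apply/eqP/(etrans _ sumM); rewrite size_flatten /shape -map_comp sumnE big_map.
  by rewrite big_enum; apply: eq_bigr => c _; rewrite /= size_nseq.
pose t := Tuple sz_s; exists [ffun x => tnth t x].
apply/ffunP=> c; apply: val_inj; rewrite /= contentE.
transitivity (count_mem c t).
  rewrite -[in RHS](map_tnth_enum t) count_map cardE size_filter enumT.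
  by apply: eq_count => x; rewrite -[LHS]/([ffun y => tnth t y] x == c) ffunE.
rewrite count_flatten -map_comp sumnE big_map big_enum /= (bigD1 c) //=.
rewrite count_nseq /= eqxx mul1n big1 ?addn0 // => d /negbTE dc.
by rewrite count_nseq /= dc.
Qed.

(** The colourings with content M form one orbit, so this is the orbit-stabiliser
formula. *)
Lemma sum_card_stab (M : {ffun C -> 'I_n.+1}) : (\sum_c M c = n)%N ->
  (\sum_(f | content f == M) #|stab f| = n`!)%N.
Proof.
move=> /content_surj[f0 f0M].
transitivity (\sum_(f | content f == M) \sum_(g : 'S_n) (recolour f0 g == f))%N.
  apply: eq_bigr => f /eqP fM; rewrite -sum1_card [LHS]big_mkcond /=.
  have [h ->] : exists h, f = recolour f0 h by apply: content_inj; rewrite fM.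
  rewrite [RHS](reindex_inj (mulIg h)); apply: eq_bigr => g _ /=.
  by rewrite inE recolourM; case: eqP.
rewrite exchange_big /= -[in RHS](card_Sn n) -sum1_card.
apply: eq_big => // g _.
rewrite (bigD1 (recolour f0 g)) ?content_recolour ?f0M //= eqxx big1 // => f.
by case/andP=> _; rewrite eq_sym => /negbTE->.
Qed.

(** A sum over colourings weighted by their stabilisers is n! times a sum over the
contents, i.e. over the orbits. *)
Lemma sum_stab_content (R : pzRingType) (A : colouring -> R)
    (H : {ffun C -> 'I_n.+1} -> R) :
    (forall f, A f = H (content f)) ->
  \sum_f (A f * #|stab f|%:R)
    = (n`!)%:R * \sum_(M : {ffun C -> 'I_n.+1} | (\sum_c M c == n)%N) H M.
Proof.
move=> AH; rewrite (partition_big content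
  (fun M : {ffun C -> 'I_n.+1} => (\sum_c M c == n)%N)) /=; last first.
  move=> f _; apply/eqP/(etrans _ (card_ord n)).
  rewrite -sum1_card (partition_big f xpredT) //=.
  by apply: eq_bigr => c _; rewrite contentE -sum1_card.
rewrite mulr_sumr; apply: eq_bigr => M /eqP sumM.
rewrite -(sum_card_stab sumM) natr_sum mulr_suml; apply: eq_bigr => f /eqP <-.
by rewrite AH; rewrite commr_nat.
Qed.

End Colourings.

(** * Cauchy's identity *)

Section EnergyCompositions.

Variables (C : finType) (B : nat) (V : zmodType) (R : comPzRingType).
Variables (w : C -> V) (F : V -> R).

(** The sum of F (v - sum_c M c w c) over all the compositions M of N indexed by
C, the parts being bounded by B to make the range finite. *)
Definition comp_sum N (v : V) : R :=
  \sum_(M : {ffun C -> 'I_B.+1} | (\sum_c M c == N)%N) F (v - \sum_c w c *+ M c).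

(** Write N as the sum of the parts M c, and each part M c as the number of r < M c;
removing r + 1 from the part indexed by c leaves a composition of N - (r + 1). *)
Lemma comp_sum_energy N v : (N <= B)%N ->
  comp_sum N v *+ N
    = \sum_c \sum_(r < N) comp_sum (N - r.+1)%N (v - w c *+ r.+1).
Proof.
move=> leNB; rewrite /comp_sum -sumrMnl.
transitivity (\sum_c \sum_(r < N)
    \sum_(M : {ffun C -> 'I_B.+1} | (\sum_c M c == N)%N && (r < M c)%N)
       F (v - \sum_c w c *+ M c)).
  under [RHS]eq_bigr => c _.
    under eq_bigr => r _ do rewrite big_mkcondr.
    rewrite exchange_big; over.
  rewrite [RHS]exchange_big /=; apply: eq_bigr => M /eqP sumM.
  rewrite -[in LHS]sumM -sumrMnr; apply: eq_bigr => c _.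
  have le_c : (M c <= N)%N by rewrite -sumM (bigD1 c) //= leq_addr.
  rewrite -big_mkcond /= -(big_ord_widen N (fun=> F _)) //.
  by rewrite sumr_const card_ord.
apply: eq_bigr => c _; apply: eq_bigr => r _.
pose up (M : {ffun C -> 'I_B.+1}) : {ffun C -> 'I_B.+1} :=
  [ffun d => inord (M d + (d == c) * r.+1)].
pose down (M : {ffun C -> 'I_B.+1}) : {ffun C -> 'I_B.+1} :=
  [ffun d => inord (M d - (d == c) * r.+1)].
have downE M d : down M d = (M d - (d == c) * r.+1)%N :> nat.
  by rewrite ffunE inordK // ltnS (leq_trans (leq_subr _ _)) // -ltnS.
have upE (M : {ffun C -> 'I_B.+1}) d :
  (M c + r.+1 <= B)%N -> up M d = (M d + (d == c) * r.+1)%N :> nat.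
  move=> leB; rewrite ffunE inordK //; case: eqP => [->|_]; first by rewrite mul1n.
  by rewrite addn0.
have sum_up (M : {ffun C -> 'I_B.+1}) :
  (M c + r.+1 <= B)%N -> (\sum_d up M d = \sum_d M d + r.+1)%N.
  move=> leB; under eq_bigr do rewrite upE //.
  rewrite big_split /=; congr (_ + _)%N.
  by rewrite (bigD1 c) //= eqxx mul1n big1 ?addn0 // => d /negbTE->.
rewrite (reindex_onto up down) /= => [|M /andP[_ rM]]; last first.
  apply/ffunP=> d; apply: val_inj; rewrite /= upE downE ?eqxx.
    by case: eqP => [->|_]; rewrite ?mul1n ?subnK // subn0 addn0.
  by rewrite mul1n subnK // -ltnS.
have le_sum (M : {ffun C -> 'I_B.+1}) : (M c <= \sum_d M d)%N.
  by rewrite (bigD1 c) //= leq_addr.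
have condE (M : {ffun C -> 'I_B.+1}) :
  [&& (\sum_d up M d == N)%N, (r < up M c)%N & down (up M) == M]
    = ((\sum_d M d == N - r.+1)%N).
  apply/idP/idP=> [/and3P[/eqP sM r_up _]|/eqP sM].
    have leB : (M c + r.+1 <= B)%N.
      rewrite leqNgt; apply/negP=> ltB; move: r_up.
      by rewrite /up ffunE eqxx mul1n /inord val_insubd; case: ifP => //; rewrite ltnS leqNgt ltB.
    by apply/eqP; move: sM; rewrite sum_up //; lia.
  have leB : (M c + r.+1 <= B)%N.
    have := le_sum M; rewrite sM; have := ltn_ord r; lia.
  rewrite sum_up // sM subnK // eqxx upE // eqxx mul1n leq_addl /=.
  by apply/eqP/ffunP=> d; apply: val_inj; rewrite /= downE upE // addnK.
apply: eq_big => [M|M]; first by rewrite -condE andbA.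
rewrite -andbA condE => /eqP sM.
have leB : (M c + r.+1 <= B)%N.
  have := le_sum M; rewrite sM; have := ltn_ord r; lia.
congr F; rewrite -addrA -opprD; congr (_ - _).
under eq_bigr do rewrite upE // mulrnDr.
rewrite big_split addrC /=; congr (_ + _).
by rewrite (bigD1 c) //= eqxx mul1n big1 ?addr0 // => d /negbTE->.
Qed.

End EnergyCompositions.

Section MatchDet.

Variable m : nat.
Local Notation vec := {ffun 'I_m -> int}.
Implicit Types (b v : vec) (s : 'S_m).

(** For vectors of distinct non-negative entries, this is the sign of the permutation
that takes b to b', or 0 when there is none.  The condition on the sign of the
entries makes moves to negative positions contribute 0. *)
Definition match_det b b' : int :=
  \det (\matrix_(i < m, j < m) ((0 <= b i) && (b i == b' j))%:Z).

Definition match_at (x y : int) : int := ((0 <= x) && (x == y))%:Z.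

Lemma match_detE b b' :
  match_det b b' = \sum_(s : 'S_m) (-1) ^+ s * \prod_i match_at (b i) (b' (s i)).
Proof.
by apply: eq_bigr => s _; congr (_ * _); apply: eq_bigr => i _; rewrite mxE.
Qed.

Lemma weight1E b : weight 1 b = \sum_i b i - 'C(m, 2)%:Z.
Proof.
rewrite /weight; congr (_ - _); first by apply: eq_bigr => i _; rewrite divz1.
rewrite -bin2_sum big_mkord (big_morph _ PoszD (erefl _)); apply: eq_bigr => i _.
under eq_bigr do rewrite dvd1z.
rewrite -(big_ord_widen m (fun=> 1 : int)) ?(ltnW (ltn_ord i)) //.
by rewrite sumr_const card_ord natz.
Qed.

Lemma match_det_supp b b' : match_det b b' != 0 -> beads b.
Proof.
move=> nz; split=> [i k bik|i].
  apply/eqP; apply: contraNT nz => ik; apply/eqP/(determinant_alternate ik) => j.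
  by rewrite !mxE bik.
rewrite leNgt; apply: contraNN nz => bi; rewrite match_detE.
rewrite big1 // => s _; rewrite (bigD1 i) //= /match_at leNgt bi.
by rewrite mul0r mulr0.
Qed.

Lemma match_det_small b b' : \sum_i b i < 'C(m, 2)%:Z -> match_det b b' = 0.
Proof.
move=> lt_b; apply/eqP; apply: contraTT lt_b => /match_det_supp/(weight_ge0 (ltn0Sn 0)).
by rewrite weight1E subr_ge0 leNgt.
Qed.

Lemma match_det_base b b' : \sum_i b i = 'C(m, 2)%:Z ->
  match_det b b' = alt b * alt b'.
Proof.
move=> sum_b; have [alt0|/alt_neq0[s ->]] := eqVneq (alt b) 0.
  rewrite alt0 mul0r; apply/eqP/negP=> /negP/match_det_supp bb.
  have := alt_core bb; rewrite weight1E sum_b subrr alt0 eqxx.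
  by move/(_ erefl).
rewrite {2}/alt -det_tr -det_mulmx; congr (\det _); apply/matrixP=> i j.
rewrite !mxE (bigD1 (s i)) //= !mxE !ffunE eqxx mul1r big1 ?addr0 => [|k ks].
  by rewrite natz eq_sym.
by rewrite !mxE !ffunE eqz_nat (inj_eq val_inj) eq_sym (negbTE ks) mul0r.
Qed.

Lemma match_det_id b : beads b -> match_det b b = 1.
Proof.
case=> inj_b b0; rewrite -(det1 _ m); congr (\det _); apply/matrixP=> i j.
by rewrite !mxE b0 (inj_eq inj_b) natz.
Qed.

(** The total contribution, over all r > 0, of matching a - r with c and a' with
c' - r. *)
Definition cross (a a' c c' : int) : int :=
  [&& a + a' == c + c', 0 <= c, 0 <= a' & c < a]%:Z.

Lemma sum_match_diag U (a c : int) : a <= U%:Z ->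
  \sum_(r < U) match_at (a - r.+1%:Z) (c - r.+1%:Z) = match_at a c * a.
Proof.
move=> leaU; have [<-|ac] := eqVneq a c; last first.
  rewrite /match_at (negbTE ac) andbF mul0r big1 // => r _.
  by rewrite (inj_eq (addIr _)) (negbTE ac) andbF.
case: a leaU => k leaU; last first.
  by rewrite mul0r big1 // => r _; rewrite /match_at; case: leP => //; lia.
rewrite /match_at eqxx mul1r -[in RHS](card_ord k) -sum1_card.
rewrite (big_ord_widen U (fun=> 1%N)) // [in RHS]big_mkcond (big_morph _ PoszD (erefl _)).
by apply: eq_bigr => r _; rewrite eqxx andbT subr_ge0 lez_nat; case: ltnP.
Qed.


Lemma sum_match_cross U (a a' c c' : int) : a <= U%:Z ->
  \sum_(r < U) match_at (a - r.+1%:Z) c * match_at a' (c' - r.+1%:Z) = cross a a' c c'.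
Proof.
move=> leaU; rewrite /cross; case: and4P => [[/eqP sum_ac c0 a'0 ca]|ncross].
  have rU : (`|(a - c - 1)%R| < U)%N by lia.
  rewrite (bigD1 (Ordinal rU)) //= big1 => [|r]; rewrite /match_at.
    have -> : a - `|(a - c - 1)%R|%N.+1%:Z = c by lia.
    have -> : c' - `|(a - c - 1)%R|%N.+1%:Z = a' by lia.
    by rewrite c0 a'0 !eqxx addr0.
  rewrite -val_eqE /= => r_ac; have -> : (a - r.+1%:Z == c) = false by lia.
  by rewrite andbF mul0r.
rewrite big1 // => r _; rewrite /match_at.
case: leP => //= ar; case: eqP => //= arc; case: leP => //= a'0; case: eqP => //= a'c.
by case: ncross; split; lia.
Qed.


(** The four terms arise from [cross a a' c c'] by exchanging a with a', or c with
c'.  When a + a' = c + c', the comparisons of a' and c' are opposite to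
those of a and c, so the strict inequalities cancel and equalities remain. *)
Lemma cross_sym (a a' c c' : int) :
  cross a a' c c' - cross a a' c' c + cross a' a c' c - cross a' a c c'
   = match_at a c' * match_at a' c - match_at a c * match_at a' c'.
Proof.
rewrite /cross /match_at [a' + a]addrC [c' + c]addrC.
have [sum_ac|nsum] /= := eqVneq (a + a') (c + c'); last first.
  have [e|] := eqVneq a c'; have [e'|] := eqVneq a' c; have [f|] := eqVneq a c;
    have [f'|] := eqVneq a' c'; rewrite ?andbF ?mulr0 ?mul0r //; lia.
have -> : (c' < a') = (a < c) by lia.
have -> : (c < a') = (a < c') by lia.
have -> : (a' == c') = (a == c) by lia.
have -> : (a' == c) = (a == c') by lia.
case: (ltrgtP a c) => ac; case: (ltrgtP a c') => ac';
  case: (lerP 0 a) => a0; case: (lerP 0 a') => a'0;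
  case: (lerP 0 c) => c0; case: (lerP 0 c') => c'0 //=; lia.
Qed.


(** The alternating sum of the Leibniz formula in which rows i and k are treated
jointly by f. *)
Definition pair_det b b' i k (f : int -> int -> int) : int :=
  \sum_(s : 'S_m) (-1) ^+ s * (f (b' (s i)) (b' (s k))
    * \prod_(l | (l != i) && (l != k)) match_at (b l) (b' (s l))).

Lemma pair_det_flip b b' i k f : i != k ->
  pair_det b b' i k (fun c c' => f c' c) = - pair_det b b' i k f.
Proof.
move=> ik; rewrite /pair_det (reindex_inj (mulgI (tperm i k))) -sumrN.
apply: eq_bigr => s _; rewrite odd_permM odd_tperm ik /= !permM tpermL tpermR.
rewrite signrN mulNr; congr (- (_ * (_ * _))).
by apply: eq_bigr => l /andP[li lk]; rewrite permM tpermD // eq_sym.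
Qed.

Lemma pair_detB b b' i k f g :
  pair_det b b' i k (fun c c' => f c c' - g c c')
    = pair_det b b' i k f - pair_det b b' i k g.
Proof.
by rewrite /pair_det -sumrB; apply: eq_bigr => s _; rewrite mulrBl mulrBr.
Qed.

Lemma pair_det_sym b b' i k f :
  pair_det b b' k i f = pair_det b b' i k (fun c c' => f c' c).
Proof.
apply: eq_bigr => s _; congr (_ * (_ * _)).
by apply: eq_bigl => l; rewrite andbC.
Qed.

Lemma pair_det_match b b' i k : i != k ->
  pair_det b b' i k (fun c c' => match_at (b i) c * match_at (b k) c')
    = match_det b b'.
Proof.
move=> ik; rewrite match_detE; apply: eq_bigr => s _; congr (_ * _).
by rewrite [RHS](bigD1 i) //= [in RHS](bigD1 k) 1?eq_sym //= mulrA.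
Qed.

Lemma pair_det_cross b b' i k : i != k ->
  pair_det b b' i k (cross (b i) (b k)) + pair_det b b' k i (cross (b k) (b i))
    = - match_det b b'.
Proof.
move=> ik; rewrite [X in _ + X]pair_det_sym.
set x := pair_det b b' i k (cross _ _); set y := pair_det _ _ _ _ _.
(* The four sums of [cross_sym] are x, - x, y and - y. *)
have Ex : pair_det b b' i k (fun c c' => cross (b i) (b k) c' c) = - x.
  exact: pair_det_flip.
have Ey : pair_det b b' i k (cross (b k) (b i)) = - y.
  by rewrite -(pair_det_flip _ _ _ ik).
have : (x + x) + (y + y) = - (match_det b b' + match_det b b').
  rewrite -[in RHS](pair_det_match b b' ik) [RHS]opprD.
  rewrite -{1}(pair_det_flip b b' _ ik) /= -pair_detB.
  transitivity (pair_det b b' i k (fun c c' =>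
     (cross (b i) (b k) c c' - cross (b i) (b k) c' c)
     - (cross (b k) (b i) c c' - cross (b k) (b i) c' c))).
    by rewrite !pair_detB Ex Ey; rewrite !opprK opprD opprK -/y; ring.
  apply: eq_bigr => s _; congr (_ * (_ * _)); rewrite -cross_sym.
  ring.
lia.
Qed.

(** Expand all determinants.  In the s-th term, removing r from b i and from
b' (s i) gives b i times the original term, when summed over r; removing r
from b i and from b' (s k) with k != i gives [cross], and each pair of
rows contributes - [match_det b b'] by [pair_det_cross]. *)
Lemma match_det_energy U b b' : (forall i, b i <= U%:Z) ->
  \sum_i \sum_j \sum_(r < U) match_det (b - unitv i *+ r.+1) (b' - unitv j *+ r.+1)
    = match_det b b' * (\sum_i b i - 'C(m, 2)%:Z).
Proof.
move=> leU; pose z i k := pair_det b b' i k (cross (b i) (b k)).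
have diag i (s : 'S_m) :
    \sum_(r < U) \prod_l match_at ((b - unitv i *+ r.+1) l)
                                   ((b' - unitv (s i) *+ r.+1) (s l))
      = b i * \prod_l match_at (b l) (b' (s l)).
  rewrite [in RHS](bigD1 i) //= mulrA [b i * _]mulrC -(sum_match_diag _ (leU i)).
  rewrite mulr_suml; apply: eq_bigr => r _; rewrite (bigD1 i) //=.
  rewrite !sub_unitvE !eqxx !mul1n; congr (_ * _); apply: eq_bigr => l li.
  by rewrite !sub_unitvE (inj_eq perm_inj) (negbTE li) !subr0.
have off i k (s : 'S_m) : k != i ->
    \sum_(r < U) \prod_l match_at ((b - unitv i *+ r.+1) l)
                                   ((b' - unitv (s k) *+ r.+1) (s l))
      = cross (b i) (b k) (b' (s i)) (b' (s k))
        * \prod_(l | (l != i) && (l != k)) match_at (b l) (b' (s l)).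
  move=> ki; rewrite -(sum_match_cross _ _ _ (leU i)) mulr_suml.
  apply: eq_bigr => r _; rewrite (bigD1 i) //= (bigD1 k) //= mulrA.
  rewrite !sub_unitvE !(inj_eq perm_inj) !eqxx (negbTE ki) eq_sym (negbTE ki).
  rewrite !mul1n !mul0n !subr0; congr (_ * _); apply: eq_bigr => l /andP[li lk].
  by rewrite !sub_unitvE (inj_eq perm_inj) (negbTE li) (negbTE lk) !subr0.
transitivity (match_det b b' * \sum_i b i + \sum_i \sum_(k | k != i) z i k).
  transitivity (\sum_(s : 'S_m) (-1) ^+ s * \sum_i \sum_k \sum_(r < U)
      \prod_l match_at ((b - unitv i *+ r.+1) l)
                       ((b' - unitv (s k) *+ r.+1) (s l))).
    have reindex_pos i (s : 'S_m) : \sum_k \sum_(r < U)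
          \prod_l match_at ((b - unitv i *+ r.+1) l)
                           ((b' - unitv (s k) *+ r.+1) (s l))
        = \sum_j \sum_(r < U) \prod_l match_at ((b - unitv i *+ r.+1) l)
                                             ((b' - unitv j *+ r.+1) (s l)).
      by rewrite [RHS](reindex_inj (@perm_inj _ s)).
    under [RHS]eq_bigr => s _ do rewrite mulr_sumr.
    rewrite [RHS]exchange_big; apply: eq_bigr => i _.
    under [RHS]eq_bigr => s _ do rewrite reindex_pos mulr_sumr.
    rewrite [RHS]exchange_big; apply: eq_bigr => j _.
    under [RHS]eq_bigr => s _ do rewrite mulr_sumr.
    by rewrite [RHS]exchange_big; apply: eq_bigr => r _; rewrite match_detE.
  have -> : match_det b b' * \sum_i b i = \sum_(s : 'S_m) (-1) ^+ s
      * \sum_i b i * \prod_l match_at (b l) (b' (s l)).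
    rewrite match_detE mulr_suml; apply: eq_bigr => s _.
    by rewrite -mulr_suml -mulrA [_ * \sum_i b i]mulrC.
  have -> : \sum_i \sum_(k | k != i) z i k = \sum_(s : 'S_m) (-1) ^+ s
      * \sum_i \sum_(k | k != i) (cross (b i) (b k) (b' (s i)) (b' (s k))
        * \prod_(l | (l != i) && (l != k)) match_at (b l) (b' (s l))).
    under [RHS]eq_bigr => s _ do rewrite mulr_sumr.
    rewrite [RHS]exchange_big; apply: eq_bigr => i _.
    under [RHS]eq_bigr => s _ do rewrite mulr_sumr.
    by rewrite [RHS]exchange_big.
  rewrite -big_split; apply: eq_bigr => s _ /=; rewrite -mulrDr; congr (_ * _).
  rewrite -big_split; apply: eq_bigr => i _ /=; rewrite (bigD1 i) //= diag.
  by congr (_ + _); apply: eq_bigr => k /off->.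
suff sum_z : \sum_i \sum_(k | k != i) z i k = - (match_det b b' * 'C(m, 2)%:Z).
  by rewrite sum_z mulrBr.
have : \sum_i \sum_(k | k != i) z i k + \sum_i \sum_(k | k != i) z i k
    = - (match_det b b' * (m * m.-1)%N%:Z).
  rewrite {2}(exchange_big_dep xpredT) //= -big_split /=.
  under eq_bigr => i _.
    rewrite [X in _ + X](eq_bigl (fun k => k != i)) => [|k]; last by rewrite eq_sym.
    rewrite -big_split /=.
    under eq_bigr => k ki do rewrite pair_det_cross 1?eq_sym //.
    rewrite sumr_const cardC1 card_ord; over.
  by rewrite sumr_const card_ord -mulrnA mulNrn mulnC -mulr_natr natz.
have := mul_bin_diag m 1; rewrite bin1 => ->; rewrite PoszM mulrCA.
lia.
Qed.

End MatchDet.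

Section CauchyKernel.

Variables m B : nat.
Local Notation vec := {ffun 'I_m -> int}.

Definition unit_pair (c : 'I_m * 'I_m) : vec * vec := (unitv c.1, unitv c.2).

Definition alt_pair (v : vec * vec) : int := alt v.1 * alt v.2.

Lemma sub_unit_pair (v : vec * vec) c r :
  v - unit_pair c *+ r = (v.1 - unitv c.1 *+ r, v.2 - unitv c.2 *+ r).
Proof. by apply: injective_projections; rewrite raddfB raddfMn. Qed.

(** The coefficient form of Cauchy's identity: a(x) a(y) / prod_(i,j) (1 - x_i y_j) is,
up to sign, the determinant of the 1 / (1 - x_i y_j), where a is the Vandermonde
alternant.  Both sides satisfy the same recursion on N, by [comp_sum_energy]
and [match_det_energy], because N is the sum of b minus 'C(m, 2). *)
Lemma comp_sum_alt N (b b' : vec) : (N <= B)%N ->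
    \sum_i b i = (N + 'C(m, 2))%N%:Z ->
  comp_sum B unit_pair alt_pair N (b, b') = match_det b b'.
Proof.
elim/ltn_ind: N b b' => -[|N] IH b b' leNB sum_b.
  rewrite match_det_base // /comp_sum (big_pred1 [ffun=> ord0]) => [|M].
    by rewrite big1 ?subr0 // => c _; rewrite ffunE mulr0n.
  rewrite sum_nat_eq0; apply/forallP/eqP => [M0|-> c]; last by rewrite ffunE.
  by apply/ffunP=> c; apply/val_inj; rewrite /= ffunE; apply/eqP/(M0 c).
have N0 : (N.+1%:R : int) != 0 by rewrite pnatr_eq0.
apply: (mulIf N0); rewrite mulr_natr comp_sum_energy //.
(* The terms with r >= N.+1 vanish: the sum of the entries is then too small.
   They are added because [match_det_energy] needs a bound on all the b i. *)
pose U := (N.+1 + \sum_i `|b i|)%N.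
have leU i : b i <= U%:Z.
  have : (`|b i| <= \sum_i `|b i|)%N by rewrite (bigD1 i) //= leq_addr.
  by rewrite /U; lia.
have -> : match_det b b' * N.+1%:R = match_det b b' * (\sum_i b i - 'C(m, 2)%:Z).
  by rewrite sum_b natz PoszD addrK.
rewrite -(match_det_energy b' leU) [RHS]pair_big /=; apply: eq_bigr => c _.
rewrite (big_ord_widen U (fun r => comp_sum B unit_pair alt_pair (N.+1 - r.+1)%N
   ((b, b') - unit_pair c *+ r.+1))) ?leq_addr // big_mkcond /=.
apply: eq_bigr => r _; case: ltnP => [rN|Nr].
  rewrite sub_unit_pair IH ?sum_sub_unitv ?sum_b //; lia.
by rewrite match_det_small // sum_sub_unitv sum_b; lia.
Qed.

End CauchyKernel.

(** * The Frobenius class functions *)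

Section Frobenius.

Variables n m : nat.
Local Notation vec := {ffun 'I_m -> int}.
Local Notation G := [set: 'S_n].
Implicit Types (b : vec) (f : {ffun 'I_n -> 'I_m}) (g h : 'S_n).

Definition content_vec f : vec := \sum_x unitv (f x).

(** The coefficient of x^b in the Vandermonde alternant times the product of the power
sums p_r(x) over the cycle lengths r of g: a colouring constant on the
cycles chooses one variable for each cycle. *)
Definition frob_val b g : int := \sum_(f | recolour f g == f) alt (b - content_vec f).

Lemma content_vec_recolour f h : content_vec (recolour f h) = content_vec f.
Proof.
rewrite /content_vec [RHS](reindex_inj (@perm_inj _ h)).
by apply: eq_bigr => x _; rewrite ffunE.
Qed.

Lemma stab_recolour (C : finType) (f : {ffun 'I_n -> C}) g h :
  (g \in stab (recolour f h)) = ((g ^ h)%g \in stab f).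
Proof.
rewrite !inE -(inj_eq (can_inj (recolourK h^-1%g))) /= !recolourM.
by rewrite mulVg recolour1 conjgE mulgA.
Qed.

Lemma card_stab_recolour (C : finType) (f : {ffun 'I_n -> C}) h :
  #|stab (recolour f h)| = #|stab f|.
Proof.
rewrite -!sum1_card [RHS](reindex_inj (conjg_inj h)).
by apply: eq_bigl => g; apply: stab_recolour.
Qed.

Lemma frob_valJ b g h : frob_val b (g ^ h)%g = frob_val b g.
Proof.
rewrite /frob_val [RHS](reindex_inj (can_inj (recolourK h))) /=.
apply: eq_big => f; last by rewrite content_vec_recolour.
by have := stab_recolour f g h; rewrite !inE.
Qed.

Fact frob_subproof b : is_class_fun <<G>>%g [ffun g => (frob_val b g)%:~R].
Proof.
by rewrite genGid; apply: intro_class_fun => [g h _ _|g]; rewrite ?frob_valJ ?inE.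
Qed.

Definition frob b : 'CF(G) := Cfun 0 (frob_subproof b).

Lemma frobE b g : frob b g = (frob_val b g)%:~R.
Proof. exact: cfunE. Qed.

(** Up to the order of the stabiliser, the multiplicity of the trivial character in
the restriction of chi to the stabiliser of f (see [stab_sum_cfdot]). *)
Definition stab_sum (C : finType) (chi : 'CF(G)) (f : {ffun 'I_n -> C}) : algC :=
  \sum_(g in stab f) (chi g)^*.

Lemma stab_sum_recolour (C : finType) chi (f : {ffun 'I_n -> C}) h :
  stab_sum chi (recolour f h) = stab_sum chi f.
Proof.
rewrite /stab_sum [RHS](reindex_inj (conjg_inj h)); apply: eq_big => g.
  exact: stab_recolour.
by move=> _; rewrite cfunJ ?inE.
Qed.

Lemma stab_sum_cfdot (C : finType) chi (f : {ffun 'I_n -> C}) :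
  stab_sum chi f = '[1, 'Res[stab_group f] chi] * #|stab f|%:R.
Proof.
rewrite cfdotE mulrAC mulVf ?mul1r ?pnatr_eq0 -?lt0n ?stab_gt0 //.
by apply: eq_bigr => g fg; rewrite cfun1E fg mul1r cfResE ?subsetT.
Qed.

Lemma card_symmetric : #|G| = n`!.
Proof. by rewrite cardsT card_Sn. Qed.

Lemma cfdot_frob b chi :
  '[frob b, chi] = (n`!)%:R^-1
    * \sum_(f : {ffun 'I_n -> 'I_m}) (alt (b - content_vec f))%:~R * stab_sum chi f.
Proof.
rewrite cfdotE card_symmetric; congr (_ * _).
under eq_bigr => g _ do rewrite frobE rmorph_sum mulr_suml big_mkcond.
rewrite exchange_big; apply: eq_bigr => f _; rewrite mulr_sumr.
rewrite [RHS]big_mkcond; apply: eq_big => g; first by rewrite inE.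
by move=> _; rewrite inE.
Qed.

Lemma content_vec_content f : content_vec f = \sum_c unitv c *+ content f c.
Proof. exact: sum_content. Qed.

(** The coefficient on 'chi_i is a sum over orbits of colourings, and each orbit
contributes an integer times the multiplicity of the trivial character of the
stabiliser in 'chi_i. *)
Lemma frob_vchar b : frob b \in 'Z[irr G]%g.
Proof.
rewrite (cfun_sum_cfdot (frob b)); apply: rpred_sum => i _.
apply: scale_zchar; last exact: irr_vchar.
pose A f := (alt (b - content_vec f))%:~R * (stab_sum 'chi[G]_i f / #|stab f|%:R).
pose H (M : {ffun 'I_m -> 'I_n.+1}) :=
  if [pick f | content f == M] is Some f then A f else 0.
have AH f : A f = H (content f).
  rewrite /H; case: pickP => [f' /eqP/content_inj[h ->]|/(_ f)/eqP//].
  by rewrite /A content_vec_recolour stab_sum_recolour card_stab_recolour.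
have n0 f : #|stab f|%:R != 0 :> algC by rewrite pnatr_eq0 -lt0n stab_gt0.
rewrite cfdot_frob; have -> :
    \sum_(f : {ffun 'I_n -> 'I_m}) (alt (b - content_vec f))%:~R * stab_sum 'chi[G]_i f
      = \sum_f A f * #|stab f|%:R.
  by apply: eq_bigr => f _; rewrite /A mulrA divfK.
rewrite (sum_stab_content AH) mulKf ?pnatr_eq0 -?lt0n ?fact_gt0 //.
apply: rpred_sum => M _; rewrite /H; case: pickP => [f _|_]; last exact: rpred0.
rewrite rpredM ?rpred_int // stab_sum_cfdot mulfK //; apply: intr_nat.
by rewrite Cnat_cfdot_char ?cfRes_char ?irr_char ?cfun1_char.
Qed.

(** A pair of colourings fixed by g is a colouring by pairs that is fixed by g. *)
Lemma frob_val_sqr b g :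
  frob_val b g * frob_val b g = \sum_(f : {ffun 'I_n -> 'I_m * 'I_m} | recolour f g == f)
    alt_pair ((b, b) - \sum_x unit_pair (f x)).
Proof.
rewrite /frob_val big_distrlr pair_big /=.
pose parts (f : {ffun 'I_n -> 'I_m * 'I_m}) :=
  ([ffun x => (f x).1], [ffun x => (f x).2]) : {ffun 'I_n -> 'I_m} * {ffun 'I_n -> 'I_m}.
pose glue (f : {ffun 'I_n -> 'I_m} * {ffun 'I_n -> 'I_m}) :=
  [ffun x => (f.1 x, f.2 x)] : {ffun 'I_n -> 'I_m * 'I_m}.
have partsK : cancel parts glue.
  by move=> f; apply/ffunP=> x; rewrite !ffunE /=; case: (f x).
have glueK : cancel glue parts.
  case=> f f'; apply: injective_projections; apply/ffunP=> x;
    by rewrite /parts /glue /= !ffunE.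
rewrite (reindex parts) /=; last by exists glue => f _; [apply: partsK|apply: glueK].
apply: eq_big => [f|f _].
  apply/andP/eqP => [[/eqP/ffunP f1 /eqP/ffunP f2]|/ffunP fg].
    apply/ffunP=> x; have := f1 x; have := f2 x; rewrite !ffunE.
    by case: (f _) (f x) => ? ? [? ?] /= -> ->.
  by split; apply/eqP/ffunP=> x; have := fg x; rewrite !ffunE => ->.
pose S := \sum_x unit_pair (f x).
transitivity (alt (b - S.1) * alt (b - S.2)); last by [].
have -> : S.1 = content_vec [ffun x => (f x).1].
  by rewrite (raddf_sum fst); apply: eq_bigr => x _; rewrite ffunE.
have -> // : S.2 = content_vec [ffun x => (f x).2].
by rewrite (raddf_sum snd); apply: eq_bigr => x _; rewrite ffunE.
Qed.

(** The norm is a sum over colourings by pairs, weighted by their stabilisers, hence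
a sum over matrices of non-negative integers with sum n, to which
[comp_sum_alt] applies. *)
Lemma frob_norm b : beads b -> \sum_i b i = (n + 'C(m, 2))%N%:Z -> '[frob b] = 1.
Proof.
move=> bb sum_b; rewrite cfdotE card_symmetric.
have n0 : (n`!)%:R != 0 :> algC by rewrite pnatr_eq0 -lt0n fact_gt0.
apply: (mulfI n0); rewrite mulVKf // mulr1.
pose A (f : {ffun 'I_n -> 'I_m * 'I_m}) : int :=
  alt_pair ((b, b) - \sum_x unit_pair (f x)).
transitivity ((\sum_f (A f * #|stab f|%:R))%:~R : algC).
  rewrite (eq_bigl xpredT) => [|g]; last by rewrite inE.
  under eq_bigr => g _.
    rewrite frobE rmorph_int -rmorphM frob_val_sqr; over.
  rewrite -rmorph_sum; congr _%:~R.
  under eq_bigr => g _ do rewrite big_mkcond.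
  rewrite exchange_big; apply: eq_bigr => f _; rewrite -big_mkcond /= -/(A f).
  by rewrite -sum1_card natr_sum mulr_sumr; apply: eq_big => g; rewrite ?inE ?mulr1.
pose H (M : {ffun 'I_m * 'I_m -> 'I_n.+1}) :=
  alt_pair ((b, b) - \sum_c unit_pair c *+ M c).
have AH F : A F = H (content F) by rewrite /A /H sum_content.
have := comp_sum_alt b (leqnn n) sum_b; rewrite /comp_sum => K_eq.
by rewrite (sum_stab_content AH) K_eq match_det_id // mulr1 natz -pmulrn.
Qed.

Lemma frob_irr b : beads b -> \sum_i b i = (n + 'C(m, 2))%N%:Z ->
  exists (e : bool) i, frob b = (-1) ^+ e *: 'chi[G]_i.
Proof. by move=> bb sum_b; apply: vchar_norm1P; [apply: frob_vchar|apply: frob_norm]. Qed.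

End Frobenius.

(** * Every irreducible character is a Frobenius class function *)

Section Exhaustion.

Variable n : nat.
Local Notation vec := {ffun 'I_n -> int}.
Local Notation G := [set: 'S_n].
Local Notation perm_vec u := ([ffun i => (u i : nat)%:Z] : vec).
Implicit Types (f : {ffun 'I_n -> 'I_n}) (u w : 'S_n).

Lemma content_vecE f i : content_vec f i = (content f i)%:Z.
Proof.
rewrite content_vec_content sum_ffunE (bigD1 i) //= ffunMnE ffunE eqxx big1 ?addr0 ?natz //.
by move=> k ki; rewrite ffunMnE ffunE eq_sym (negbTE ki) mul0rn.
Qed.

(** Put d = u - w.  The square norm of the content of f' exceeds that of f by
|d|^2 + 2 <content f, d>, where the second term is non-negative and the sum is
at most 0; hence d = 0. *)
Lemma perm_vec_extremal f f' u w :
    (\sum_i content f' i ^ 2 <= \sum_i content f i ^ 2)%N ->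
    (\sum_i content f i * w i <= \sum_i content f i * u i)%N ->
  content_vec f + perm_vec u - content_vec f' = perm_vec w -> content_vec f' = content_vec f.
Proof.
move=> le_sq le_uw eq_w.
have uw i : content_vec f' i = content_vec f i + (u i : nat)%:Z - (w i : nat)%:Z.
  move: (content_vec f) (content_vec f') eq_w => c c' /ffunP/(_ i).
  by rewrite !ffunE => <-; rewrite opprB addrC subrK.
have sum0 : \sum_i ((u i : nat)%:Z - (w i : nat)%:Z) ^+ 2 = 0.
  apply/eqP; rewrite eq_le sumr_ge0 ?andbT => [|i _]; last exact: sqr_ge0.
  have -> : \sum_i ((u i : nat)%:Z - (w i : nat)%:Z) ^+ 2
      = (\sum_i content f' i ^ 2)%N%:Z - (\sum_i content f i ^ 2)%N%:Z
        + 2 * ((\sum_i content f i * w i)%N%:Z - (\sum_i content f i * u i)%N%:Z).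
    rewrite !(big_morph _ PoszD (erefl _)) -!sumrB mulr_sumr -big_split /=.
    apply: eq_bigr => i _; have := uw i; rewrite !content_vecE => c'.
    by rewrite -!mulnn !PoszM c'; ring.
  move: le_sq le_uw; move: (\sum_i content f' i ^ 2)%N (\sum_i content f i ^ 2)%N.
  by move: (\sum_i content f i * w i)%N (\sum_i content f i * u i)%N; lia.
apply/ffunP=> i; rewrite uw.
have /eqP := sum0; rewrite psumr_eq0 => [/allP/(_ i (mem_index_enum i))|? _]; last exact: sqr_ge0.
by rewrite /= sqrf_eq0 -addrA => /eqP->; rewrite addr0.
Qed.

(** Take a colouring f with nonzero [stab_sum chi f] whose content has the largest
square norm, and a permutation u whose scalar product with that content is
largest.  For b = content f + u, the only colourings that contribute to
'[frob b, chi] are those with the content of f, by [perm_vec_extremal], and they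
all contribute the same.  (This is the triangularity of the transition from
permutation characters to irreducible ones.) *)
Lemma frob_exhaust (chi : 'CF(G)) : chi 1%g != 0 -> exists b : vec, '[frob n b, chi] != 0.
Proof.
move=> chi1.
(* The stabiliser of an injective colouring is trivial. *)
pose f0 : {ffun 'I_n -> 'I_n} := [ffun x => x].
have S0 : stab_sum chi f0 != 0.
  rewrite /stab_sum (big_pred1 1%g) ?conjC_eq0 // => g; rewrite !inE.
  apply/eqP/eqP => [/ffunP fg|->]; last exact: recolour1.
  by apply/permP=> x; have := fg x; rewrite !ffunE perm1.
case: (@arg_maxnP _ f0 (fun f => stab_sum chi f != 0)
  (fun f => \sum_i content f i ^ 2)%N S0) => f Sf max_f.
case: (@arg_maxnP _ (1%g : 'S_n) xpredT (fun u => \sum_i content f i * u i)%N isT).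
move=> u _ max_u; exists (content_vec f + perm_vec u).
rewrite cfdot_frob mulf_neq0 ?invr_eq0 ?pnatr_eq0 -?lt0n ?fact_gt0 //.
have -> : \sum_(f' : {ffun 'I_n -> 'I_n})
      (alt (content_vec f + perm_vec u - content_vec f'))%:~R * stab_sum chi f'
    = \sum_(f' : {ffun 'I_n -> 'I_n} | content_vec f' == content_vec f)
        (-1) ^+ u * stab_sum chi f.
  rewrite [RHS]big_mkcond; apply: eq_bigr => f' _; case: eqP => [eq_wt|neq_wt].
    rewrite eq_wt addrAC subrr add0r alt_perm rmorph_sign; congr (_ * _).
    suff /content_inj[h ->] : content f = content f' by rewrite stab_sum_recolour.
    by apply/ffunP=> i; apply/val_inj; have := content_vecE f' i; rewrite eq_wt content_vecE => -[].
  have [->|Sf'] := eqVneq (stab_sum chi f') 0; first by rewrite mulr0.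
  have [->|/alt_neq0[w eq_w]] := eqVneq (alt (content_vec f + perm_vec u - content_vec f')) 0.
    by rewrite mul0r.
  by case: neq_wt; apply: perm_vec_extremal eq_w; [apply: max_f|apply: max_u].
rewrite sumr_const mulrn_eq0 mulf_eq0 signr_eq0 (negbTE Sf) !orbF -lt0n.
by apply/card_gt0P; exists f; apply: eqxx.
Qed.

Lemma cfdot_frob_permv (chi : 'CF(G)) (b : vec) u :
  '[frob n (permv u b), chi] = (-1) ^+ u * '[frob n b, chi].
Proof.
rewrite !cfdot_frob mulrCA; congr (_ * _); rewrite mulr_sumr.
pose shift f : {ffun 'I_n -> 'I_n} := [ffun x => (u^-1)%g (f x)].
pose unshift f : {ffun 'I_n -> 'I_n} := [ffun x => u (f x)].
have shiftK : cancel shift unshift by move=> f; apply/ffunP=> x; rewrite !ffunE permKV.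
rewrite (reindex_inj (can_inj shiftK)); apply: eq_bigr => f _.
have -> : permv u b - content_vec (shift f) = permv u (b - content_vec f).
  apply/ffunP=> i; rewrite !ffunE; congr (_ - _); rewrite !sum_ffunE.
  by apply: eq_bigr => x _; rewrite !ffunE -(inj_eq (@perm_inj _ u)) permKV.
rewrite alt_permv rmorphM rmorph_sign -mulrA; congr (_ * (_ * _)).
apply: eq_bigl => g; rewrite !inE; apply/eqP/eqP=> /ffunP fg; apply/ffunP=> x.
  by have := fg x; rewrite !ffunE => /perm_inj.
by have := fg x; rewrite !ffunE => ->.
Qed.

(** The inner product of [frob b] and chi is nonzero for some b.  Such a b has distinct
non-negative entries, so [frob b] is irreducible up to sign, and equals
chi up to sign. *)
Theorem irr_frob (chi : 'CF(G)) : chi \in irr G -> exists b : vec,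
  [/\ beads b, \sum_i b i = (n + 'C(n, 2))%N%:Z
    & exists e : bool, chi = (-1) ^+ e *: frob n b].
Proof.
case/irrP=> i ->; have [|b nz] := @frob_exhaust 'chi_i; first exact: irr1_neq0.
have [f] : exists f, alt (b - content_vec f) != 0.
  apply/existsP; apply: contraNT nz => /existsPn alt0; rewrite cfdot_frob.
  by rewrite big1 ?mulr0 // => f _; have := alt0 f; rewrite negbK => /eqP->; rewrite mul0r.
case/alt_supp=> bf0 sum_bf.
have bfE k : (b - content_vec f) k = b k - content_vec f k.
  by move: (content_vec f) => v; rewrite !ffunE.
have b0 k : 0 <= b k by rewrite -(subrK (content_vec f k) (b k)) -bfE addr_ge0 // content_vecE.
have sum_b : \sum_k b k = (n + 'C(n, 2))%N%:Z.
  have sum_wt : \sum_k content_vec f k = n.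
    under eq_bigr do rewrite sum_ffunE.
    rewrite exchange_big -[in RHS](card_ord n) -sum1_card (big_morph _ PoszD (erefl _)).
    apply: eq_bigr => x _; rewrite (bigD1 (f x)) //= ffunE eqxx big1 ?addr0 //.
    by move=> k /negbTE kx; rewrite ffunE kx.
  rewrite PoszD -sum_wt -sum_bf -big_split; apply: eq_bigr => k _ /=.
  by rewrite bfE addrC subrK.
have inj_b : injective b.
  move=> k l bkl; apply/eqP; apply: contraNT nz => kl.
  have b_t : permv (tperm k l) b = b.
    by apply/ffunP=> j; rewrite ffunE; case: tpermP => // ->.
  have := cfdot_frob_permv 'chi_i b (tperm k l); rewrite b_t odd_tperm kl expr1 mulN1r.
  by move/eqP; rewrite -addr_eq0 -mulr2n mulrn_eq0.
have [e [j b_j]] := frob_irr (conj inj_b b0) sum_b.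
exists b; split=> //; exists e; rewrite b_j scalerA -signr_addb addbb scale1r.
congr 'chi_ _; move: nz.
by rewrite b_j cfdotZl cfdot_irr; case: (j =P i) => // _; rewrite mulr0 eqxx.
Qed.

End Exhaustion.

(** * Values at elements of a given cycle type *)

Section CycleTypes.

Lemma sum_mn m (s : seq nat) (b : {ffun 'I_m -> int}) :
  \sum_(F : {ffun 'I_(size s) -> 'I_m}) alt (b - \sum_k unitv (F k) *+ nth 0%N s k)
    = mn b s.
Proof.
elim: s b => [|r s IH] b /=.
  rewrite (big_pred1 (@ffun0 _ (fun=> 'I_m) (card_ord 0))) => [|F].
    by rewrite big_ord0 subr0.
  by apply/esym/eqP/ffunP=> -[].
rewrite (partition_big (fun F : {ffun 'I_(size s).+1 -> 'I_m} => F ord0) xpredT) //=.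
apply: eq_bigr => i _; rewrite -IH.
pose glue (F : {ffun 'I_(size s) -> 'I_m}) : {ffun 'I_(size s).+1 -> 'I_m} :=
  [ffun k => oapp F i (unlift ord0 k)].
pose tail (F : {ffun 'I_(size s).+1 -> 'I_m}) : {ffun 'I_(size s) -> 'I_m} :=
  [ffun k => F (lift ord0 k)].
rewrite (reindex_onto glue tail) /= => [|F /eqP F0]; last first.
  by apply/ffunP=> k; rewrite ffunE; case: unliftP => [k' ->|->]; rewrite /= ?ffunE.
apply: eq_big => [F|F _]; last first.
  rewrite big_ord_recl ffunE unlift_none /= opprD addrA; congr (alt (_ - _)).
  by apply: eq_bigr => k _; rewrite ffunE liftK.
rewrite ffunE unlift_none eqxx; apply/eqP/ffunP=> k.
by rewrite ffunE ffunE liftK.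
Qed.

(** If idx labels the cycles of g, then the colourings fixed by g are the colourings
of the labels. *)
Lemma frob_val_blocks n m (s : seq nat) (g : 'S_n) (idx : 'I_n -> 'I_(size s))
    (b : {ffun 'I_m -> int}) :
    (forall k, #|[pred x | idx x == k]| = nth 0%N s k) ->
    (forall k : 'I_(size s), 0 < nth 0 s k)%N ->
    (forall x, idx (g x) = idx x) ->
    (forall f : {ffun 'I_n -> 'I_m}, recolour f g = f ->
       forall x y, idx x = idx y -> f x = f y) ->
  frob_val b g = mn b s.
Proof.
move=> card_idx s_gt0 idx_g idx_trans; rewrite -sum_mn.
have /fin_all_exists[rep repK] (k : 'I_(size s)) : exists x, idx x = k.
  by have := s_gt0 k; rewrite -card_idx => /card_gt0P[x /eqP]; exists x.
pose spread (F : {ffun 'I_(size s) -> 'I_m}) : {ffun 'I_n -> 'I_m} := [ffun x => F (idx x)].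
pose pick (f : {ffun 'I_n -> 'I_m}) : {ffun 'I_(size s) -> 'I_m} := [ffun k => f (rep k)].
rewrite /frob_val (reindex_onto spread pick) /= => [|f /eqP fg]; last first.
  by apply/ffunP=> x; rewrite !ffunE; apply: (idx_trans _ fg); rewrite repK.
apply: eq_big => [F|F _].
  by apply/andP; split; apply/eqP/ffunP=> k; rewrite !ffunE ?idx_g ?repK.
congr (alt (_ - _)); rewrite /content_vec (partition_big idx xpredT) //=.
apply: eq_bigr => k _; rewrite -card_idx -sumr_const.
by apply: eq_bigr => x /eqP idx_x; rewrite ffunE idx_x.
Qed.

Lemma frob_val_one n m (b : {ffun 'I_m -> int}) :
  frob_val b (1 : 'S_n)%g = mn b (nseq n 1%N).
Proof.
have sz : n = size (nseq n 1%N) by rewrite size_nseq.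
have lt_n (k : 'I_(size (nseq n 1%N))) : (k < n)%N.
  by case: k => k; rewrite size_nseq.
apply: (@frob_val_blocks _ _ _ _ (cast_ord sz)) => [k|k|x|f _ x y /cast_ord_inj->//].
- rewrite nth_nseq lt_n; apply: etrans (card1 (cast_ord (esym sz) k)).
  apply: eq_card => x; rewrite !inE.
  by rewrite -(inj_eq (@cast_ord_inj _ _ (esym sz))) cast_ordK.
- by rewrite nth_nseq lt_n.
by rewrite perm1.
Qed.

Lemma uniq_flatten_nth (T : eqType) (ss : seq (seq T)) :
    uniq (flatten ss) ->
  (forall i, uniq (nth [::] ss i)) /\
  (forall i j x, x \in nth [::] ss i -> x \in nth [::] ss j -> i = j).
Proof.
elim: ss => [|s ss IH] /=; first by split=> [i|i j x]; rewrite nth_nil.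
rewrite cat_uniq => /and3P[us /hasPn dis /IH[uss diss]].
have dis' j x : x \in s -> x \in nth [::] ss j -> False.
  move=> xs xj; suff /dis/negP : x \in flatten ss by [].
  apply/flattenP; exists (nth [::] ss j) => //; apply/mem_nth.
  by rewrite ltnNge; apply/negP=> le_j; rewrite nth_default in xj.
split=> [[|i] //=|[|i] [|j] x //=]; last by move=> xi /(diss _ _ _ xi)->.
  by move=> xs /(dis' _ _ xs).
by move=> xi xs; case: (dis' _ _ xs xi).
Qed.

(** Cut the list of all points into consecutive blocks of the prescribed sizes, and
let g permute each block cyclically. *)
Lemma exists_cycle_type n (s : seq nat) : sumn s = n -> 0%N \notin s ->
  exists g : 'S_n,
    (forall m (b : {ffun 'I_m -> int}), frob_val b g = mn b s)
    /\ (forall N, (forall r, r \in s -> (r %| N)%N) -> (g ^+ N = 1)%g).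
Proof.
move=> sum_s s_gt0; pose blocks := reshape s (enum 'I_n).
have size_n : size (enum 'I_n) = sumn s by rewrite size_enum_ord.
have flat : flatten blocks = enum 'I_n by rewrite reshapeKr ?size_n.
have shapeE : shape blocks = s by rewrite reshapeKl ?size_n.
have size_b : size blocks = size s by rewrite -[in RHS]shapeE size_map.
have [ub db] : (forall i, uniq (nth [::] blocks i)) /\ (forall i j x,
    x \in nth [::] blocks i -> x \in nth [::] blocks j -> i = j).
  by apply: uniq_flatten_nth; rewrite flat enum_uniq.
have idx_lt (x : 'I_n) : (find (fun bl => x \in bl) blocks < size s)%N.
  rewrite -size_b -has_find.
  by apply/hasP/flattenP; rewrite flat mem_enum.
pose idx x := Ordinal (idx_lt x); pose bl x := nth [::] blocks (idx x).
have mem_bl x : x \in bl x.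
  by rewrite /bl; apply: (@nth_find _ [::] (fun bl => x \in bl)); rewrite has_find size_b.
have idxE x y : x \in bl y -> idx x = idx y.
  by move=> xy; apply: val_inj; apply: db (mem_bl x) xy.
have bl_nx x : bl (next (bl x) x) = bl x.
  by rewrite {1}/bl (idxE _ x) // mem_next.
have nxK : cancel (fun x => next (bl x) x) (fun x => prev (bl x) x).
  by move=> x /=; rewrite bl_nx prev_next //; apply: ub.
pose g : 'S_n := perm (can_inj nxK).
have gE x : g x = next (bl x) x by rewrite permE.
have iter_g x k : iter k g x = iter k (next (bl x)) x.
  suff [] : iter k g x = iter k (next (bl x)) x /\ bl (iter k g x) = bl x by [].
  by elim: k => //= k [IH IHbl]; rewrite gE bl_nx IHbl IH.
have cyc x : fcycle (next (bl x)) (bl x) by apply/cycle_next/ub.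
exists g; split=> [m b|N dvdN].
  apply: (@frob_val_blocks _ _ _ _ idx) => [k|k|x|f fg x y].
  - have -> : nth 0%N s k = size (nth [::] blocks k).
      by rewrite -(@nth_map _ [::] _ 0%N size) ?size_b // -/(shape blocks) shapeE.
    have /card_uniqP <- := ub k; apply: eq_card => x; rewrite inE.
    by apply/eqP/idP=> [<-|xk]; [apply: mem_bl|apply: val_inj; apply: db (mem_bl x) xk].
  - by rewrite lt0n; apply: contra s_gt0 => /eqP<-; apply: mem_nth.
  - by rewrite gE; apply: idxE; rewrite mem_next.
  - move=> xy; have : fconnect (next (bl x)) x y.
      by rewrite (fconnect_cycle (cyc x) (mem_bl x)) /bl xy; apply: mem_bl.
    move/iter_findex => <-; rewrite -iter_g; elim: (findex _ _ _) => //= k ->.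
    by have /ffunP/(_ (iter k g x)) := fg; rewrite ffunE.
apply/permP=> x; rewrite permX perm1 iter_g.
have /dvdnP[c ->] : (size (bl x) %| N)%N.
  apply: dvdN; rewrite -shapeE; apply: map_f; apply: mem_nth.
  by rewrite size_b.
rewrite iterM iter_fix // -(order_cycle (cyc x) (ub _) (mem_bl x)).
exact: iter_order_cycle (cyc x) _ _ (mem_bl x) (mem_bl x).
Qed.

End CycleTypes.

(** * Comparison of degrees *)

Lemma frob_chardeg n (chi : 'CF([set: 'S_n])) (b : {ffun 'I_n -> int}) (e : bool) :
  chi \in irr [set: 'S_n] -> chi = (-1) ^+ e *: frob n b ->
  chardeg chi = `|mn b (nseq n 1%N)|%N.
Proof.
move=> /irrP[i chi_i] chi_b; rewrite /chardeg.
have -> : chi 1%g = `|mn b (nseq n 1%N)|%N%:R.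
  rewrite -[LHS]ger0_norm ?chi_i ?char1_ge0 ?irr_char // -chi_i chi_b cfunE.
  by rewrite normrMsign frobE frob_val_one -intr_norm -abszE -pmulrn.
exact: natrK.
Qed.

(** Up to conjugacy, the p-element that [mn_weight_eq] provides for psi lies in P, where
it compares the weights of chi and psi. *)
Lemma logn_chardeg_le n p (chi psi : 'CF([set: 'S_n])) (P : {group 'S_n}) :
    prime p -> (p.-Sylow([set: 'S_n]) P)%g ->
    chi \in irr [set: 'S_n] -> psi \in irr [set: 'S_n] ->
    {in P, forall g, chi g = 0 -> psi g = 0} ->
  (logn p (chardeg chi) <= logn p (chardeg psi))%N.
Proof.
move=> p_pr sylP irr_chi irr_psi van; have p_gt1 := prime_gt1 p_pr.
have [b [bb sum_b [e chi_b]]] := irr_frob irr_chi.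
have [c [cc sum_c [e' psi_c]]] := irr_frob irr_psi.
(* J is such that p^J exceeds all the entries of b and c. *)
pose J := (\sum_i `|b i| + \sum_i `|c i|)%N.
have bJ i : (`|b i| < p ^ J)%N.
  apply: leq_ltn_trans (ltn_expl J p_gt1).
  by rewrite /J (bigD1 i) //= -addnA leq_addr.
have cJ i : (`|c i| < p ^ J)%N.
  apply: leq_ltn_trans (ltn_expl J p_gt1).
  by rewrite /J addnC (bigD1 i) //= -addnA leq_addr.
have [ks [sorted_ks le_ks nz_c weight_c]] := mn_weight_eq p_gt1 J cc.
have sum_ks : sumn (pparts p ks) = n.
  by have [_] := mn_supp nz_c; rewrite sum_c => -[] /addIn.
have ks_gt0 : 0%N \notin pparts p ks.
  by apply/mapP=> -[k _ /esym/eqP]; rewrite expn_eq0 -leqn0 leqNgt (ltnW p_gt1).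
have [g [frob_g g_exp]] := exists_cycle_type sum_ks ks_gt0.
have p_g : (p.-group <[g]>)%g.
  rewrite /pgroup -orderE; apply: (@pnat_dvd _ (p ^ J)); last by rewrite pnatX pnat_id.
  rewrite order_dvdn; apply/eqP/g_exp => _ /mapP[k k_ks ->].
  by apply: dvdn_exp2l; apply: (allP le_ks).
have [x Gx] := Sylow_Jsub sylP (subsetT _) p_g.
rewrite -cycleJ cycle_subG => Pgx.
have nz_b : mn b (pparts p ks) != 0.
  have valE d (k : {ffun 'I_n -> int}) :
      (((-1) ^+ d *: frob n k) (g ^ x)%g == 0) = (mn k (pparts p ks) == 0).
    by rewrite cfunE mulf_eq0 signr_eq0 cfunJ ?inE // frobE frob_g intr_eq0.
  rewrite -(valE e) -chi_b; apply: contraNN nz_c; rewrite -(valE e') -psi_c.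
  by move/eqP/van => ->.
have weight_bc k : (k <= J)%N -> weight (p ^ k) c <= weight (p ^ k) b.
  by move=> kJ; rewrite weight_c // mn_weight_ge.
rewrite (frob_chardeg irr_chi chi_b) (frob_chardeg irr_psi psi_c).
have := logn_mn_ones p_pr bb sum_b bJ; have := logn_mn_ones p_pr cc sum_c cJ.
have : \sum_(1 <= k < J.+1) weight (p ^ k) c <= \sum_(1 <= k < J.+1) weight (p ^ k) b.
  by rewrite big_nat [leRHS]big_nat; apply: ler_sum => k /andP[_ kJ]; apply: weight_bc.
lia.
Qed.

Theorem theoremS2 (n p : nat) (hp : prime p)
    (P : {group 'S_n}) (hP : P \in 'Syl_p([set: 'S_n])%g)
    (chi psi : 'CF([set: 'S_n]))
    (hchi : chi \in irr [set: 'S_n]) (hpsi : psi \in irr [set: 'S_n]) :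
  (Van ('Res[P] chi) \subset Van ('Res[P] psi) ->
     ((chardeg chi)`_p <= (chardeg psi)`_p)%N)
  /\ (Van ('Res[P] chi) = Van ('Res[P] psi) ->
     ((chardeg chi)`_p = (chardeg psi)`_p)%N).
Proof.
have sylP : (p.-Sylow([set: 'S_n]) P)%g by rewrite inE in hP.
have le_part (phi xi : 'CF([set: 'S_n])) :
    phi \in irr [set: 'S_n] -> xi \in irr [set: 'S_n] ->
    Van ('Res[P] phi) \subset Van ('Res[P] xi) ->
  ((chardeg phi)`_p <= (chardeg xi)`_p)%N.
  move=> irr_phi irr_xi /subsetP van; rewrite !p_part leq_exp2l ?prime_gt1 //.
  apply: (logn_chardeg_le hp sylP irr_phi irr_xi) => g Pg phi0.
  have := van g; rewrite !inE Pg !cfResE ?subsetT // phi0 eqxx.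
  by move/(_ isT)/eqP.
split=> [|eq_van]; first exact: le_part.
by apply/eqP; rewrite eqn_leq !le_part // eq_van.
Qed.
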